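(* Let $\alpha_1,\alpha_2,\beta_1,\beta_2>0$, $\nu\in(0,1)$, let $\tilde X^{\nu,\mu}(t):=X^1(\tilde S^{\nu,\mu}(t))$ be the time-changed process described in the context, and let $\Lambda$ be the function in the context. Assume that $\mu>0$, and set $$\tilde\Lambda_{\nu,\mu}(\gamma):=\begin{cases}\mu^\nu-(\mu-\Lambda(\gamma))^\nu&\text{if }\Lambda(\gamma)\leq\mu,\\\infty&\text{otherwise}.\end{cases}$$ Then, for all $k\in\mathbb{Z}$, the family of laws $\left\{P\left(\frac{\tilde X^{\nu,\mu}(t)}{t}\in\cdot\,\Big|\,\tilde X^{\nu,\mu}(0)=k\right):t>0\right\}$ on $\mathbb{R}$ satisfies the large deviation principle with speed function $v_t=t$ and good rate function $\tilde\Lambda_{\nu,\mu}^*(y):=\sup_{\gamma\in\mathbb{R}}\{\gamma y-\tilde\Lambda_{\nu,\mu}(\gamma)\}$.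
   Context: $\{X^1(t):t\geq 0\}$ is the continuous-time Markov chain on $\mathbb{Z}$ whose state probabilities $p_{k,n}(t):=P(X^1(t)=n|X^1(0)=k)$ satisfy $p_{k,n}(0)=1_{\{k=n\}}$ and whose generator $g_{k,n}:=\lim_{t\to 0}\frac{p_{k,n}(t)-p_{k,n}(0)}{t}$ is as follows. For even $k$: $g_{k,k+1}=\alpha_1$, $g_{k,k-1}=\alpha_2$, $g_{k,k}=-(\alpha_1+\alpha_2)$. For odd $k$: $g_{k,k+1}=\beta_1$, $g_{k,k-1}=\beta_2$, $g_{k,k}=-(\beta_1+\beta_2)$. All other entries are $0$. $\{S^\nu(t):t\geq0\}$ is the $\nu$-stable subordinator: $\mathbb{E}[e^{\gamma S^\nu(t)}]=e^{-|\gamma|^\nu t}$ if $\gamma\leq0$ and $=\infty$ otherwise; $f_{S^\nu(t)}$ denotes the density of $S^\nu(t)$, $t>0$. For $\mu>0$, $\{\tilde S^{\nu,\mu}(t):t\geq0\}$ is the tempered stable subordinator, i.e. the subordinator with $\tilde S^{\nu,\mu}(0)=0$ and, for $t>0$, $P(\tilde S^{\nu,\mu}(t)\in dx)=e^{-\mu x+\mu^\nu t}f_{S^\nu(t)}(x)\,dx$. Hence for $t>0$, $\mathbb{E}[e^{\gamma\tilde S^{\nu,\mu}(t)}]=e^{-t((\mu-\gamma)^\nu-\mu^\nu)}$ if $\gamma\leq\mu$ and $=\infty$ otherwise. $\tilde S^{\nu,\mu}$ is independent of $X^1$. For $z>0$, $h(z):=\frac12\sqrt{(\alpha_1+\alpha_2-(\beta_1+\beta_2))^2z^2+4(\beta_1z^2+\beta_2)(\alpha_1z^2+\alpha_2)}$;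 for $\gamma\in\mathbb{R}$, $\Lambda(\gamma):=\frac{h(e^\gamma)}{e^\gamma}-\frac{\alpha_1+\alpha_2+\beta_1+\beta_2}{2}$. Large deviation principle: a family of probability measures $\{\pi_t:t>0\}$ on a topological space $\mathcal{Y}$ satisfies the large deviation principle with rate function $I$ and speed function $v_t$ if $\lim_{t\to+\infty}v_t=+\infty$, $I:\mathcal{Y}\to[0,+\infty]$ is lower semicontinuous, $\liminf_{t\to+\infty}\frac{1}{v_t}\log\pi_t(O)\geq-\inf_{y\in O}I(y)$ for all open sets $O$, and $\limsup_{t\to+\infty}\frac{1}{v_t}\log\pi_t(C)\leq-\inf_{y\in C}I(y)$ for all closed sets $C$. The rate function $I$ is good if all level sets $\{y\in\mathcal{Y}:I(y)\leq\eta\}$, $\eta\geq0$, are compact. *)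

(* Defs.v *)
From HB Require Import structures.
From mathcomp Require Import all_boot all_order all_algebra.
From mathcomp Require Import all_classical all_reals all_analysis.
Import Order.TTheory GRing.Theory Num.Theory.
Import numFieldNormedType.Exports.

Set Implicit Arguments.
Unset Strict Implicit.
Unset Printing Implicit Defensive.

Local Open Scope classical_set_scope.
Local Open Scope ring_scope.

(* Time is a real parameter; only times t >= 0 are ever constrained. *)

Definition cond_prob (R : realType) (d : measure_display) (T : measurableType d)
    (P : probability T R) (A B : set T) : R :=
  fine (P (A `&` B)) / fine (P B).

Record transition_function (R : realType) (p : R -> int -> int -> R) : Prop := {
  transition_init : forall k n, p 0 k n = (k == n)%:R ;
  transition_ge0 : forall (t : R) k n, 0 <= t -> 0 <= p t k n ;
  transition_sum1 : forall (t : R) k, 0 <= t ->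
    (\esum_(n in [set: int]) (p t k n)%:E = 1)%E ;
  chapman_kolmogorov : forall (s t : R) k n, 0 <= s -> 0 <= t ->
    (\esum_(j in [set: int]) (p s k j * p t j n)%:E = (p (s + t) k n)%:E)%E }.

Definition has_generator (R : realType) (p : R -> int -> int -> R)
    (g : int -> int -> R) : Prop :=
  forall k n, (p t k n - p 0 k n) / t @[t --> 0^'+] --> g k n.

(* Continuous-time Markov chain on the integers with transition function p, with
   right-continuous (hence locally constant to the right) paths.  The case
   m = 0, t 0 = 0 of markov_property says p t k n = P(X t = n | X 0 = k). *)
Record markov_chain (R : realType) (d : measure_display) (T : measurableType d)
    (P : probability T R) (p : R -> int -> int -> R) (X : R -> T -> int) : Prop := {
  chain_transition : transition_function p ;
  chain_measurable : forall (t : R) n, 0 <= t -> measurable [set w | X t w = n] ;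
  chain_right_continuous : forall w (t : R), 0 <= t -> \forall s \near t^'+, X s w = X t w ;
  markov_property : forall (m : nat) (t : nat -> R) (n : nat -> int),
    0 <= t 0%N -> {homo t : i j / (i < j)%N >-> i < j} ->
    let past := \bigcap_(i in `I_m.+1) [set w | X (t i) w = n i] in
    (0 < P past)%E ->
    cond_prob P [set w | X (t m.+1) w = n m.+1] past
      = p (t m.+1 - t m) (n m) (n m.+1) }.

Definition alternating_generator (R : realType) (a1 a2 b1 b2 : R) (k n : int) : R :=
  let up := if odd `|k|%N then b1 else a1 in
  let down := if odd `|k|%N then b2 else a2 in
  if n == k + 1 then up
  else if n == k - 1 then down
  else if n == k then - (up + down)
  else 0.

Record subordinator (R : realType) (d : measure_display) (T : measurableType d)
    (P : probability T R) (S : R -> T -> R) : Prop := {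
  subordinator_measurable : forall t : R, 0 <= t -> measurable_fun setT (S t) ;
  subordinator_init : forall w, S 0 w = 0 ;
  subordinator_nondecreasing : forall w (s t : R), 0 <= s -> s <= t -> S s w <= S t w ;
  subordinator_right_continuous : forall w (t : R), 0 <= t ->
    S s w @[s --> t^'+] --> S t w ;
  subordinator_stationary : forall (s t : R) (A : set R), 0 <= s -> 0 <= t ->
    measurable A ->
    P [set w | A (S (s + t) w - S s w)] = P [set w | A (S t w)] ;
  subordinator_independent : forall (m : nat) (t : nat -> R) (A : nat -> set R),
    0 <= t 0%N -> {homo t : i j / (i < j)%N >-> i < j} ->
    (forall i, measurable (A i)) ->
    P (\bigcap_(i in `I_m) [set w | A i (S (t i.+1) w - S (t i) w)])
      = (\prod_(i < m) P [set w | A i (S (t i.+1) w - S (t i) w)%R])%E }.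

Record stable_subordinator (R : realType) (d : measure_display)
    (T : measurableType d) (P : probability T R) (nu : R) (S : R -> T -> R) : Prop := {
  stable_is_subordinator : subordinator P S ;
  stable_mgf_le0 : forall t c : R, 0 < t -> c <= 0 ->
    (\int[P]_w (expR (c * S t w))%:E = (expR (- (`|c| `^ nu * t)))%:E)%E ;
  stable_mgf_gt0 : forall t c : R, 0 < t -> 0 < c ->
    (\int[P]_w (expR (c * S t w))%:E = +oo)%E }.

Record has_density (R : realType) (d : measure_display) (T : measurableType d)
    (P : probability T R) (Y : T -> R) (f : R -> R) : Prop := {
  density_measurable : measurable_fun setT f ;
  density_ge0 : forall x, 0 <= f x ;
  density_law : forall A : set R, measurable A ->
    (P [set w | A (Y w)] = \int[lebesgue_measure]_(x in A) (f x)%:E)%E }.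

(* f t is meant to be the density of the nu-stable subordinator at time t. *)
Record tempered_stable_subordinator (R : realType) (d : measure_display)
    (T : measurableType d) (P : probability T R) (nu mu : R) (f : R -> R -> R)
    (S : R -> T -> R) : Prop := {
  tempered_is_subordinator : subordinator P S ;
  tempered_density : forall t : R, 0 < t ->
    has_density P (S t) (fun x => expR (- mu * x + mu `^ nu * t) * f t x) }.

Definition chain_sigma (R : realType) (T : Type) (X : R -> T -> int) : set (set T) :=
  <<s [set E | exists2 t : R, 0 <= t & exists n, E = [set w | X t w = n]] >>.

Definition real_process_sigma (R : realType) (T : Type) (S : R -> T -> R) :
    set (set T) :=
  <<s [set E | exists2 t : R, 0 <= t & exists2 A : set R, measurable A &
        E = [set w | A (S t w)]] >>.

Definition independent_processes (R : realType) (d : measure_display)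
    (T : measurableType d) (P : probability T R)
    (X : R -> T -> int) (S : R -> T -> R) : Prop :=
  forall A B, chain_sigma X A -> real_process_sigma S B ->
    (P (A `&` B) = P A * P B)%E.

Definition time_change (R : realType) (T : Type) (X : R -> T -> int)
    (S : R -> T -> R) (t : R) (w : T) : int := X (S t w) w.

Definition scaled_law (R : realType) (d : measure_display) (T : measurableType d)
    (P : probability T R) (X : R -> T -> int) (k : int) (t : R) (A : set R) : \bar R :=
  (cond_prob P [set w | A ((X t w)%:~R / t)] [set w | X 0 w = k])%:E.

Definition h (R : realType) (a1 a2 b1 b2 z : R) : R :=
  2^-1 * Num.sqrt ((a1 + a2 - (b1 + b2)) ^+ 2 * z ^+ 2
                   + 4 * (b1 * z ^+ 2 + b2) * (a1 * z ^+ 2 + a2)).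

Definition Lambda (R : realType) (a1 a2 b1 b2 c : R) : R :=
  h a1 a2 b1 b2 (expR c) / expR c - (a1 + a2 + b1 + b2) / 2.

Definition tLambda (R : realType) (a1 a2 b1 b2 nu mu c : R) : \bar R :=
  if Lambda a1 a2 b1 b2 c <= mu
  then (mu `^ nu - (mu - Lambda a1 a2 b1 b2 c) `^ nu)%:E
  else +oo%E.

Definition legendre (R : realType) (L : R -> \bar R) (y : R) : \bar R :=
  ereal_sup [set ((c * y)%:E - L c)%E | c in [set: R]].

Definition ld_rate_function (R : realType) (Y : topologicalType)
    (I : Y -> \bar R) : Prop :=
  (forall y, (0 <= I y)%E) /\ lower_semicontinuous I.

(* The family is given by set functions; the first clause of ldp says that each
   pi t, t > 0, is a probability measure on the Borel sets of Y. *)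
Definition borel_probability (R : realType) (Y : ptopologicalType)
    (m : set Y -> \bar R) : Prop :=
  exists Q : probability (g_sigma_algebraType (@open Y)) R,
    forall A, <<s @open Y >> A -> m A = Q A.

(* lne is the extended logarithm, with lne 0 = -oo. *)
Record ldp (R : realType) (Y : ptopologicalType) (pi : R -> set Y -> \bar R)
    (v : R -> R) (I : Y -> \bar R) : Prop := {
  ldp_probability : forall t : R, 0 < t -> borel_probability (pi t) ;
  ldp_speed : v t @[t --> +oo] --> +oo ;
  ldp_rate : ld_rate_function I ;
  ldp_open : forall O : set Y, open O ->
    (- ereal_inf (I @` O)
      <= limf_einf (fun t => ((v t)^-1)%:E * lne (pi t O)) (pinfty_nbhs R))%E ;
  ldp_closed : forall C : set Y, closed C ->
    (limf_esup (fun t => ((v t)^-1)%:E * lne (pi t C)) (pinfty_nbhs R)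
      <= - ereal_inf (I @` C))%E }.

Definition good_rate_function (R : realType) (Y : topologicalType)
    (I : Y -> \bar R) : Prop :=
  ld_rate_function I /\
  forall eta : R, 0 <= eta -> compact [set y | (I y <= eta%:E)%E].

(* Main.v *)
(* The generator of X^1 is invariant under translation by 2, so its eigenfunctions
   phi(n) = exp(g n) w(parity of n) come from a 2 x 2 matrix whose Perron root is
   Lambda(g).  Uniformization gives E_k[phi(X^1(t))] = exp(t Lambda(g)) phi(k)
   exactly, and independence of the subordinator turns this into
   E_k[phi(X(t))] = phi(k) E[exp(Lambda(g) S(t))] = phi(k) exp(t tLambda(g)).
   As phi is comparable to exp(g n), the moment generating function of X(t) equals
   exp(t tLambda(g)) up to constants depending only on g.

   The large deviation principle is then an elementary one-dimensional
   Gaertner-Ellis argument: Chernoff bounds on half-lines for closed sets, and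
   exponential tilting for open sets.  The latter needs every real y to be a
   derivative of tLambda at an interior point of its domain; this is the
   steepness of tLambda, which holds because Lambda crosses the level mu with
   nonzero slope while x^nu has infinite slope at 0. *)
Require Import Defs.
From HB Require Import structures.
From mathcomp Require Import all_boot all_order all_algebra.
From mathcomp Require Import all_classical all_reals all_analysis.
From mathcomp Require Import measurable_realfun zify ring lra.
Import Order.TTheory GRing.Theory Num.Theory.
Import numFieldNormedType.Exports.

Local Open Scope classical_set_scope.
Local Open Scope ring_scope.

(** * The Gaertner-Ellis theorem on the line *)

(** The chain is given only through its transition function and the derivative of that function at
    time 0, so the backward equation has to be extracted from Chapman-Kolmogorov by squeezing a
    difference quotient. The eigenfunction phi is unbounded, so the equation cannot simply be summed
    against it. Multiplying by exp(c t), with c a bound on the exit rates, makes every coefficient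
    nonnegative, and then the series of the transition matrix can be summed against phi in any
    order.

    On the large deviation side the moment generating function is known only up to factors
    independent of t, and only where tLambda is finite. Such factors vanish on the logarithmic
    scale, and the tilted lower bound uses only first-order increments of tLambda at the tilting
    point.

    The domain, where Lambda <= mu, is compact because Lambda grows in both directions. Hence c y -
    tLambda(c) attains its maximum, and once the maximizer is known to be interior, the vanishing of
    the derivative there gives the slope y. *)

Lemma legendre_ge {R : realType} (L : R -> \bar R) (c l y : R) :
  L c = l%:E -> ((c * y - l)%:E <= legendre L y)%E.
Proof.
move=> Lc; apply: ereal_sup_ubound; exists c => //.
by rewrite Lc -EFinB.
Qed.

Lemma legendre_gt {R : realType} (L : R -> \bar R) (a y : R) :
  (forall c, L c != -oo%E) -> (a%:E < legendre L y)%E ->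
  exists c l, L c = l%:E /\ a < c * y - l.
Proof.
move=> LNy /ereal_sup_gt[_ [c _ <-]].
case Lc : (L c) => [l| |]; last by have := LNy c; rewrite Lc.
- by rewrite -EFinB lte_fin => ay; exists c, l.
- by rewrite addeNy ltNge leNye.
Qed.

(* In dimension one the union of two families of half-lines contains a closed
   set only if a single half-line of each family already suffices. *)
Lemma closed_two_half_lines {R : realType} (C A B : set R) :
  closed C -> A !=set0 -> B !=set0 ->
  (forall y, C y -> (exists2 l, A l & y < l) \/ (exists2 r, B r & r < y)) ->
  exists l r, [/\ A l, B r & forall y, C y -> y < l \/ r < y].
Proof.
move=> cC [l0 Al0] [r0 Br0] CAB.
have [[l [r [Al Br rl]]]|lr] := pselect (exists l r, [/\ A l, B r & r < l]).
  exists l, r; split => // y Cy; have [|ly] := ltP y l; first by left.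
  by right; exact: lt_le_trans rl ly.
have {}lr l r : A l -> B r -> l <= r.
  by move=> Al Br; rewrite leNgt; apply/negP => rl; apply: lr; exists l, r.
have supA : has_sup A by split; [exists l0 | exists r0 => l Al; exact: lr].
have infB : has_inf B by split; [exists r0 | exists l0 => r Br; exact: lr].
(* Every point of [A] is now at most every point of [B], so [sup A] and [inf B] lie in none of the
   half-lines and hence not in [C]. Closedness keeps [C] away from a neighbourhood of each, so an
   [l] near [sup A] and an [r] near [inf B] lose no point of [C]. *)
have Cs : (~` C) (sup A).
  move=> /CAB[[l Al]|[r Br]].
    by apply/negP; rewrite -leNgt; apply: ub_le_sup => //; case: supA.
  apply/negP; rewrite -leNgt; apply: ge_sup; first by exists l0.
  by move=> l Al; exact: lr.
have Ci : (~` C) (inf B).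
  move=> /CAB[[l Al]|[r Br]].
    apply/negP; rewrite -leNgt; apply: lb_le_inf; first by exists r0.
    by move=> r Br; exact: lr.
  by apply/negP; rewrite -leNgt; apply: ge_inf => //; case: infB.
have oC : open (~` C) by exact: closed_openC.
have [/= e1 e10 Ce1] : nbhs_ball (sup A) (~` C).
  by rewrite nbhs_ballE; exact: oC.
have [/= e2 e20 Ce2] : nbhs_ball (inf B) (~` C).
  by rewrite nbhs_ballE; exact: oC.
have [l Al ll] := sup_adherent e10 supA.
have [r Br rr] := inf_adherent e20 infB.
exists l, r; split => // y Cy.
case: (CAB _ Cy) => -[z zAB yz].
- left; have zs : z <= sup A by apply: ub_le_sup => //; case: supA.
  rewrite ltNge; apply/negP => ly; apply: (Ce1 y) => //=.
  by rewrite /ball/= ger0_norm; lra.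
- right; have zs : inf B <= z by apply: ge_inf => //; case: infB.
  rewrite ltNge; apply/negP => ly; apply: (Ce2 y) => //=.
  by rewrite /ball/= distrC ger0_norm; lra.
Qed.

(** * Limits on the logarithmic scale *)

Section log_limits.
Context {R : realType}.
Implicit Types (u : R -> \bar R) (K a b : R).

Lemma limf_esup_near_le (f : R -> \bar R) (x : \bar R) :
  (\forall t \near pinfty_nbhs R, (f t <= x)%E) -> (limf_esup f (pinfty_nbhs R) <= x)%E.
Proof.
move=> fx; apply: (@le_trans _ _ (ereal_sup (f @` [set t | (f t <= x)%E]))).
  by apply: ereal_inf_lbound; exists [set t | (f t <= x)%E].
by apply: ge_ereal_sup => _ [t ? <-].
Qed.

Lemma limf_einf_near_ge (f : R -> \bar R) (x : \bar R) :
  (\forall t \near pinfty_nbhs R, (x <= f t)%E) -> (x <= limf_einf f (pinfty_nbhs R))%E.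
Proof.
move=> fx; rewrite leeNr; apply: limf_esup_near_le.
by apply: filterS fx => t; rewrite leeN2.
Qed.

Lemma near_log_le K e : 0 < K -> 0 < e ->
  \forall t \near pinfty_nbhs R, t^-1 * ln K <= e.
Proof.
move=> K0 e0; near=> t.
have t0 : 0 < t by [].
by rewrite mulrC ler_pdivrMr// -ler_pdivrMl.
Unshelve. all: by end_near. Qed.

(** The prefactor costs [t^-1 * ln K], which vanishes in the limit. The extended logarithm allows
    [u] to take the value 0. *)
Lemma limf_esup_log_le u K a : 0 < K -> (forall t, 0 <= u t)%E ->
  (exists t0, forall t, t0 < t -> (u t <= (K * expR (- (t * a)))%:E)%E) ->
  (limf_esup (fun t : R => (t^-1)%:E * lne (u t)) (pinfty_nbhs R) <= (- a)%:E)%E.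
Proof.
move=> K0 u0 [t0 uK]; apply/lee_addgt0Pr => e e0.
apply: limf_esup_near_le; near=> t.
have tpos : 0 < t by [].
have utK : (u t <= (K * expR (- (t * a)))%:E)%E.
  by apply: uK; near: t; apply: nbhs_pinfty_gt; rewrite num_real.
have Kt0 : 0 < K * expR (- (t * a)) by rewrite mulr_gt0// expR_gt0.
apply: (@le_trans _ _ (t^-1 * ln (K * expR (- (t * a))))%:E).
  rewrite EFinM lee_pmul2l ?lte_fin ?invr_gt0//.
  by rewrite -lne_EFin// lee_lne// in_itv/= leey ?u0 ?lee_fin ?(ltW Kt0).
rewrite lnM ?posrE ?expR_gt0// expRK mulrDr mulrN mulKf ?gt_eqF//.
rewrite -EFinD lee_fin addrC lerD2l.
by near: t; exact: near_log_le.
Unshelve. all: by end_near. Qed.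

Lemma limf_einf_log_ge u K b : 0 < K ->
  (exists t0, forall t, t0 < t -> ((K * expR (t * b))%:E <= u t)%E) ->
  (b%:E <= limf_einf (fun t : R => (t^-1)%:E * lne (u t)) (pinfty_nbhs R))%E.
Proof.
move=> K0 [t0 uK]; apply/lee_subgt0Pr => e e0.
apply: limf_einf_near_ge; near=> t.
have tpos : 0 < t by [].
have utK : ((K * expR (t * b))%:E <= u t)%E.
  by apply: uK; near: t; apply: nbhs_pinfty_gt; rewrite num_real.
have Kt0 : 0 < K * expR (t * b) by rewrite mulr_gt0// expR_gt0.
apply: (@le_trans _ _ (t^-1 * ln (K * expR (t * b)))%:E); last first.
  rewrite EFinM lee_pmul2l ?lte_fin ?invr_gt0//.
  rewrite -lne_EFin// lee_lne// in_itv/= leey ?lee_fin ?(ltW Kt0)//.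
  by rewrite andbT (le_trans _ utK)// lee_fin ltW.
rewrite lnM ?posrE ?expR_gt0// expRK mulrDr mulKf ?gt_eqF//.
rewrite -EFinD lee_fin addrC lerD2r lerNl -mulrN -lnV ?posrE//.
by near: t; apply: near_log_le; rewrite // invr_gt0.
Unshelve. all: by end_near. Qed.

End log_limits.

Section exponential_moments.
Context {d} {T : measurableType d} {R : realType} (Q : probability T R).
Implicit Types (A B : set T) (X Y : T -> R).

Lemma measurable_expR_comp A Y :
  measurable_fun setT Y -> measurable_fun A (EFin \o (fun w => expR (Y w))).
Proof.
move=> mY; apply/measurable_EFinP; apply: measurableT_comp => //.
exact: measurable_funS mY.
Qed.

(** Common source of the bounds below: with [X] zero it is Markov's inequality for the exponential,
    with [Y] zero a bound by a probability, and with two multiples of the same variable it is the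
    price of changing the tilt on [A]. *)
Lemma integral_expR_le A X Y (a : R) : measurable A ->
  measurable_fun setT X -> measurable_fun setT Y ->
  (forall w, w \in A -> X w <= a + Y w) ->
  (\int[Q]_(w in A) (expR (X w))%:E
    <= (expR a)%:E * \int[Q]_(w in A) (expR (Y w))%:E)%E.
Proof.
move=> mA mX mY XY.
rewrite -ge0_integralZl_EFin//.
- apply: ge0_le_integral => //.
  + exact: measurable_expR_comp.
  + by apply: emeasurable_funM => //; exact: measurable_expR_comp.
  + by move=> w Aw; rewrite -EFinM lee_fin -expRD ler_expR XY ?inE.
- exact: measurable_expR_comp.
Qed.

Lemma integral_expR0 A : measurable A ->
  (\int[Q]_(w in A) (expR 0)%:E = Q A)%E.
Proof. by move=> mA; rewrite expR0 integral_cst// mul1e. Qed.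

Lemma subset_integral_expR A Y : measurable A -> measurable_fun setT Y ->
  (\int[Q]_(w in A) (expR (Y w))%:E <= \int[Q]_w (expR (Y w))%:E)%E.
Proof.
move=> mA mY; apply: ge0_subset_integral => //; exact: measurable_expR_comp.
Qed.

Lemma integral_expR_setU_le A B Y :
  measurable A -> measurable B -> measurable_fun setT Y ->
  (\int[Q]_(w in A `|` B) (expR (Y w))%:E
    <= \int[Q]_(w in A) (expR (Y w))%:E + \int[Q]_(w in B) (expR (Y w))%:E)%E.
Proof.
move=> mA mB mY.
have -> : A `|` B = A `|` (B `\` A) by rewrite setUDr setDv setD0.
rewrite ge0_integral_setU//.
- rewrite leeD2l//; apply: ge0_subset_integral => //.
  + exact: measurableD.
  + exact: measurable_expR_comp.
- exact: measurableD.
- exact: measurable_expR_comp.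
- by rewrite disj_set_sym; apply/disj_setPS => w [[]].
Qed.

End exponential_moments.

(** Reduces an upper bound with a possibly infinite infimum of the rate to real levels. *)
Lemma lee_real_lt {R : realType} (x y : \bar R) :
  (forall a : R, (a%:E < x)%E -> (a%:E <= y)%E) -> (x <= y)%E.
Proof.
case: x => [x| |] xy; last exact: leNye.
- by apply/lee_subgt0Pr => e e0; apply: xy; rewrite lte_fin; lra.
- case: y xy => [y| |] xy //.
  + by have := xy (y + 1)%R (ltry _); rewrite lee_fin gerDl ler10.
  + by have := xy 0 (ltry _).
Qed.

(** First-order expansion on both sides of [c]. As [L] is extended valued, the derivative is that of
    a real function [l] which equals [L] near [c]. *)
Lemma is_derive_increments {R : realType} (L : R -> \bar R) (l : R -> R) (c y e : R) :
  (\forall x \near c, L x = (l x)%:E) -> is_derive c 1 l y -> 0 < e ->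
  exists2 s, 0 < s &
    exists l1 l2, [/\ L (c + s) = l1%:E, L (c - s) = l2%:E,
      l1 < l c + s * (y + e) & l2 < l c - s * (y - e)].
Proof.
move=> Ll [dl dly] e0; move: dl; rewrite /derivable -[lim _]/('D_1 l c) dly.
move=> /cvgrPdist_lt/(_ _ e0).
rewrite /dnbhs near_withinE => -[/= r1 r10 B1].
move: Ll => -[/= r2 r20 B2].
pose s := Num.min r1 r2 / 2.
have m0 : 0 < Num.min r1 r2 by rewrite lt_min r10 r20.
have s0 : 0 < s by rewrite divr_gt0.
have sr1 : s < r1.
  by rewrite /s ltr_pdivrMr// (@le_lt_trans _ _ r1) ?ge_min ?lexx//; lra.
have sr2 : s < r2.
  by rewrite /s ltr_pdivrMr// (@le_lt_trans _ _ r2) ?ge_min ?lexx ?orbT//; lra.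
exists s => //; exists (l (c + s)), (l (c - s)); split.
- by apply: B2; rewrite /ball/= opprD addNKr normrN gtr0_norm.
- by apply: B2; rewrite /ball/= subKr gtr0_norm.
- have := B1 s; rewrite /ball/= sub0r normrN gtr0_norm// => /(_ sr1).
  rewrite gt_eqF// => /(_ isT); rewrite [s%:A]mulr1 (addrC s) ltr_norml.
  move=> /andP[+ _]; set D := l (c + s) - l c; rewrite [_ *: _]mulrC => De.
  have : D / s < y + e by lra.
  by rewrite ltr_pdivrMr// /D; lra.
- have := B1 (- s); rewrite /ball/= sub0r normrN normrN gtr0_norm// => /(_ sr1).
  rewrite lt_eqF ?oppr_lt0// => /(_ isT).
  rewrite [(- s)%:A]mulr1 (addrC (- s)) ltr_norml invrN.
  move=> /andP[_]; set D := l (c - s) - l c; rewrite [_ *: _]mulrC mulrN => De.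
  have : D / s < - (y - e) by lra.
  by rewrite ltr_pdivrMr// /D; lra.
Qed.

Lemma measurable_half_line {R : realType} (a c l : R) :
  measurable [set y : R | a <= c * y - l].
Proof.
rewrite [X in measurable X](_ : _ = setT `&` (fun y => c * y - l) @^-1` `[a, +oo[).
  by apply: measurable_funB.
by rewrite setTI; apply/seteqP; split => y /=; rewrite in_itv/= andbT.
Qed.

(** * Large deviation bounds from exponential moments *)

Section gartner_ellis.
Context {d} {T : measurableType d} {R : realType} (Q : probability T R).
Variables (Z : R -> T -> R) (L : R -> \bar R).
Hypothesis mZ : forall t : R, 0 < t -> measurable_fun setT (Z t).
Hypothesis LNy : forall c : R, L c != -oo%E.
Hypothesis L0 : L 0 = 0%E.
Hypothesis Lpos : exists c l : R, 0 < c /\ L c = l%:E.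
Hypothesis Lneg : exists c l : R, c < 0 /\ L c = l%:E.
Hypothesis mgf_le : forall c l : R, L c = l%:E -> exists2 K : R, 0 < K &
  forall t : R, 0 < t ->
    (\int[Q]_w (expR (t * c * Z t w))%:E <= (K * expR (t * l))%:E)%E.
Hypothesis mgf_ge : forall c l : R, L c = l%:E -> exists2 K : R, 0 < K &
  forall t : R, 0 < t ->
    ((K * expR (t * l))%:E <= \int[Q]_w (expR (t * c * Z t w))%:E)%E.
Hypothesis L_derive : forall y : R, exists (c : R) (l : R -> R),
  (\forall x \near c, L x = (l x)%:E) /\ is_derive c 1 l y.

Let law t (A : set R) : \bar R := Q (Z t @^-1` A).

Let mZM (t c : R) : 0 < t -> measurable_fun setT (fun w => t * c * Z t w).
Proof. by move=> t0; apply: measurable_funM => //; exact: mZ. Qed.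

Let mpre (t : R) (A : set R) : 0 < t -> measurable A -> measurable (Z t @^-1` A).
Proof. by move=> t0 mA; rewrite -[X in measurable X]setTI; exact: mZ. Qed.

(** Chernoff's bound. Describing the half-line by [a <= c * y - l] instead of by an endpoint treats
    both signs of [c] at once. *)
Lemma half_line_law_le (c l a : R) : L c = l%:E ->
  exists2 K : R, 0 < K & forall t : R, 0 < t ->
    (law t [set y | (a <= c * y - l)%R] <= (K * expR (- (t * a)))%:E)%E.
Proof.
move=> /mgf_le[K K0 mK]; exists K => // t t0.
set A := [set y | _].
have mA : measurable (Z t @^-1` A).
  by apply: mpre => //; exact: measurable_half_line.
rewrite /law -(integral_expR0 Q _ mA).
apply: (@le_trans _ _ ((expR (- (t * (a + l))))%:E *
    \int[Q]_(w in Z t @^-1` A) (expR (t * c * Z t w))%:E)%E).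
  apply: integral_expR_le => //; first exact: mZM.
  move=> w /set_mem/=; rewrite /A/= => aw.
  by rewrite addrC subr_ge0 -mulrA ler_pM2l//; lra.
apply: (@le_trans _ _ ((expR (- (t * (a + l))))%:E * (K * expR (t * l))%:E)%E).
  rewrite lee_pmul2l ?lte_fin ?expR_gt0//; apply: le_trans (mK _ t0).
  by apply: subset_integral_expR => //; exact: mZM.
by rewrite -EFinM lee_fin mulrCA -expRD mulrDr opprD subrK.
Qed.

(** Each point of [C] has a slope [c] with [a < c * y - l], and [c] is nonzero because
    [L 0 = 0 <= a]. Its sign decides whether the point lies in a left or a right half-line with
    endpoint [(a + l) / c]. Two half-lines then cover [C], and Chernoff's bound applies to each. *)
Lemma law_closed_le (C : set R) (a : R) : closed C -> 0 <= a ->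
  (forall y, C y -> (a%:E < legendre L y)%E) ->
  exists2 K : R, 0 < K &
    forall t : R, 0 < t -> (law t C <= (K * expR (- (t * a)))%:E)%E.
Proof.
move=> cC a0 CI.
pose A := [set r | exists c l, [/\ c < 0, L c = l%:E & r = (a + l) / c]].
pose B := [set r | exists c l, [/\ 0 < c, L c = l%:E & r = (a + l) / c]].
have [r1 [r2 [Ar1 Br2 Cr]]] : exists r1 r2,
    [/\ A r1, B r2 & forall y, C y -> y < r1 \/ r2 < y].
  apply: closed_two_half_lines => //.
  - by have [c [l [c0 Lc]]] := Lneg; exists ((a + l) / c), c, l.
  - by have [c [l [c0 Lc]]] := Lpos; exists ((a + l) / c), c, l.
  move=> y /CI/(legendre_gt _ _ _ LNy)[c [l [Lc acy]]].
  have [c0|c0|c0] := ltgtP c 0.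
  - left; exists ((a + l) / c); first by exists c, l.
    by rewrite ltr_ndivlMr// mulrC; lra.
  - right; exists ((a + l) / c); first by exists c, l.
    by rewrite ltr_pdivrMr// mulrC; lra.
  - move: Lc acy; rewrite c0 L0 => -[<-]; rewrite mul0r subr0 => a_lt0.
    by have := lt_le_trans a_lt0 a0; rewrite ltxx.
have [c1 [l1 [c10 L1 r1E]]] := Ar1; have [c2 [l2 [c20 L2 r2E]]] := Br2.
have [K1 K10 h1] := half_line_law_le c1 l1 a L1.
have [K2 K20 h2] := half_line_law_le c2 l2 a L2.
exists (K1 + K2); first exact: addr_gt0.
move=> t t0; rewrite mulrDl EFinD.
apply: (@le_trans _ _ (law t [set y | (a <= c1 * y - l1)%R] +
    law t [set y | (a <= c2 * y - l2)%R])%E); last by apply: leeD; [exact: h1|exact: h2].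
apply: le_trans (measureU2 _ _ _); rewrite -?preimage_setU.
- apply: le_measure; rewrite ?inE.
  + by apply: mpre => //; exact: closed_measurable.
  + by apply: mpre => //; apply: measurableU; exact: measurable_half_line.
  + move=> w /= /Cr; rewrite r1E r2E => -[].
      by rewrite ltr_ndivlMr// => ?; left; lra.
    by rewrite ltr_pdivrMr// => ?; right; lra.
- by apply: mpre => //; exact: measurable_half_line.
- by apply: mpre => //; exact: measurable_half_line.
Qed.

(* Tilting by exp (t c Z t): the exponential moment concentrates on the ball,
   since outside of it the moments at c + s and c - s are exponentially smaller. *)
Lemma law_ball_ge (y : R) :
  exists c l : R, L c = l%:E /\ forall e, 0 < e -> exists2 K : R, 0 < K &
    exists t0 : R, forall t, t0 < t ->
    ((K * expR (t * (l - c * y - `|c| * e)))%:E <= law t (ball y e))%E.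
Proof.
have [c [l [Ll dl]]] := L_derive y.
have Lc : L c = (l c)%:E by exact: nbhs_singleton Ll.
exists c, (l c); split => // e e0.
have e20 : 0 < e / 2 by rewrite divr_gt0.
have [s s0 [l1 [l2 [L1 L2 l1s l2s]]]] := is_derive_increments _ _ _ _ _ Ll dl e20.
have [K K0 hK] := mgf_ge _ _ Lc.
have [K1 K10 hK1] := mgf_le _ _ L1.
have [K2 K20 hK2] := mgf_le _ _ L2.
(* On either tail, shifting the tilt by [s] gains [s * e], while the expansion of [L] loses at most
   [s * (e / 2)]; [eta] is the net gain. *)
pose eta := s * (e / 2).
have eta0 : 0 < eta by rewrite mulr_gt0.
exists (K / 2); first by rewrite divr_gt0.
(* Past this time [2 * (K1 + K2) / K <= 1 + t * eta <= expR (t * eta)], so the two tails take at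
   most half of the lower bound [K * expR (t * l c)]. *)
exists (Num.max 0 ((2 * (K1 + K2) / K - 1) / eta)) => t.
rewrite gt_max => /andP[t0 tK].
pose A0 := Z t @^-1` ball y e.
pose A1 := Z t @^-1` `[y + e, +oo[.
pose A2 := Z t @^-1` `]-oo, y - e].
have mA0 : measurable (A0) by apply: mpre => //; exact: measurable_ball.
have mA1 : measurable (A1) by exact: mpre.
have mA2 : measurable (A2) by exact: mpre.
have cover : setT = A0 `|`
    (A1 `|` A2).
  apply/esym/seteqP; split => // w _ /=; rewrite /A0 /A1 /A2 /ball/= !in_itv/= andbT.
  case: (ltP (`|y - Z t w|) e) => [|]; first by left.
  by rewrite ler_normr => /orP[|] ?; right; [right|left]; lra.
have q1 : (\int[Q]_(w in A1) (expR (t * c * Z t w))%:E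
    <= (K1 * expR (t * (l c - eta)))%:E)%E.
  apply: (@le_trans _ _ ((expR (- (t * s * (y + e))))%:E *
      \int[Q]_(w in A1) (expR (t * (c + s) * Z t w))%:E)%E).
    apply: integral_expR_le => //; [exact: mZM|exact: mZM|].
    move=> w /set_mem/=; rewrite /A1 /A2 /= in_itv/= andbT => Zw.
    rewrite addrC -subr_ge0.
    rewrite (_ : _ - _ = t * s * (Z t w - (y + e))); last by ring.
    by rewrite mulr_ge0 ?subr_ge0// mulr_ge0// ltW.
  apply: (@le_trans _ _ ((expR (- (t * s * (y + e))))%:E * (K1 * expR (t * l1))%:E)%E).
    rewrite lee_pmul2l ?lte_fin ?expR_gt0//; apply: le_trans (hK1 _ t0).
    by apply: subset_integral_expR; [exact: mA1|exact: mZM].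
  rewrite -EFinM lee_fin mulrCA -expRD ler_pM2l// ler_expR.
  rewrite -mulrA -mulrN -mulrDr ler_pM2l// /eta; lra.
have q2 : (\int[Q]_(w in A2) (expR (t * c * Z t w))%:E
    <= (K2 * expR (t * (l c - eta)))%:E)%E.
  apply: (@le_trans _ _ ((expR (t * s * (y - e)))%:E *
      \int[Q]_(w in A2) (expR (t * (c - s) * Z t w))%:E)%E).
    apply: integral_expR_le => //; [exact: mZM|exact: mZM|].
    move=> w /set_mem/=; rewrite /A1 /A2 /= in_itv/= => Zw.
    rewrite addrC -subr_ge0.
    rewrite (_ : _ - _ = t * s * (y - e - Z t w)); last by ring.
    by rewrite mulr_ge0 ?subr_ge0// mulr_ge0// ltW.
  apply: (@le_trans _ _ ((expR (t * s * (y - e)))%:E * (K2 * expR (t * l2))%:E)%E).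
    rewrite lee_pmul2l ?lte_fin ?expR_gt0//; apply: le_trans (hK2 _ t0).
    by apply: subset_integral_expR; [exact: mA2|exact: mZM].
  rewrite -EFinM lee_fin mulrCA -expRD ler_pM2l// ler_expR.
  rewrite -mulrA -mulrDr ler_pM2l// /eta; lra.
have q0 : (\int[Q]_(w in A0) (expR (t * c * Z t w))%:E
    <= (expR (t * (c * y + `|c| * e)))%:E * law t (ball y e))%E.
  rewrite /law -(integral_expR0 Q _ mA0); apply: integral_expR_le => //.
    exact: mZM.
  move=> w /set_mem/=; rewrite /A0 /ball/= addr0 -mulrA ler_pM2l// => Zw.
  rewrite -lerBlDl -mulrBr (le_trans (ler_norm _))// normrM ler_wpM2l//.
  by rewrite distrC ltW.
have qfin : law t (ball y e) \is a fin_num by exact: fin_num_measure.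
have := hK _ t0; rewrite cover => /le_trans.
move=> /(_ _ (integral_expR_setU_le _ _ _ _ mA0 (measurableU _ _ mA1 mA2) (mZM _ c t0))).
have q12 := le_trans (integral_expR_setU_le _ _ _ _ mA1 mA2 (mZM _ c t0)) (leeD q1 q2).
move=> /le_trans /(_ (leeD q0 q12)).
rewrite -(fineK qfin) -EFinM -!EFinD !lee_fin.
set q := fine _ => qK.
have tail : (K1 + K2) * expR (- (t * eta)) <= K / 2.
  rewrite expRN ler_pdivrMr ?expR_gt0//.
  apply: (@le_trans _ _ (K / 2 * (1 + t * eta))); last first.
    by rewrite ler_pM2l ?divr_gt0// expR_ge1Dx.
  move: tK; rewrite ltr_pdivrMr// ltrBlDl ltr_pdivrMr// => ?; lra.
have KK : K / 2 * expR (t * l c) <= expR (t * (c * y + `|c| * e)) * q.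
  have := ler_wpM2r (expR_ge0 (t * l c)) tail.
  by move: qK; rewrite mulrBr expRD; lra.
rewrite -(@ler_pM2l _ (expR (t * (c * y + `|c| * e)))) ?expR_gt0//.
apply: le_trans KK; rewrite mulrCA -expRD ler_pM2l ?divr_gt0// ler_expR.
by rewrite -mulrDr ler_pM2l//; lra.
Qed.

Lemma limf_esup_law_le (C : set R) : closed C ->
  (limf_esup (fun t : R => (t^-1)%:E * lne (law t C)) (pinfty_nbhs R)
    <= - ereal_inf (legendre L @` C))%E.
Proof.
move=> cC; rewrite leeNr; apply: lee_real_lt => a aC; rewrite leeNr -EFinN.
have [a0|a0] := leP 0 a.
  have [|K K0 CK] := law_closed_le C a cC a0.
    by move=> y Cy; apply: lt_le_trans aC _; apply: ereal_inf_lbound; exists y.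
  apply: (limf_esup_log_le _ _ _ K0); first by move=> t; exact: measure_ge0.
  by exists 0 => t; exact: CK.
(* For a negative level it suffices that probabilities are at most 1. *)
apply: (@le_trans _ _ (- 0)%:E); last by rewrite lee_fin lerN2 ltW.
apply: (limf_esup_log_le _ _ _ ltr01); first by move=> t; exact: measure_ge0.
exists 0 => t t0; rewrite mulr0 oppr0 expR0 mulr1.
by apply: probability_le1; apply: mpre => //; exact: closed_measurable.
Qed.

Lemma limf_einf_law_ge (O : set R) : open O ->
  (- ereal_inf (legendre L @` O)
    <= limf_einf (fun t : R => (t^-1)%:E * lne (law t O)) (pinfty_nbhs R))%E.
Proof.
move=> oO; rewrite leeNl; apply: le_ereal_inf_tmp => _ [y Oy <-]; rewrite leeNl.
have [e e0 yeO] : exists2 e : R, 0 < e & ball y e `<=` O.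
  by have [/= e e0 yeO] := oO y Oy; exists e.
(* The slope [c] depends on [y] only, so the radius can be shrunk afterwards until [|c| * s <= r].
   Any slope satisfies [- legendre L y <= l - c * y], which is the direction wanted here. *)
have [c [l [Lc hK]]] := law_ball_ge y.
apply: (@le_trans _ _ (l - c * y)%:E).
  by rewrite leeNl -EFinN opprB; exact: legendre_ge.
apply/lee_subgt0Pr => r r0.
pose s := Num.min e (r / (`|c| + 1)).
have c0 : 0 < `|c| + 1 by rewrite ltr_wpDl.
have s0 : 0 < s by rewrite lt_min e0 divr_gt0.
have csr : `|c| * s <= r.
  apply: (@le_trans _ _ ((`|c| + 1) * s)); first by rewrite ler_wpM2r ?lerDl// ltW.
  by rewrite -ler_pdivlMl// mulrC ge_min lexx orbT.
have [K K0 [t0 Kt]] := hK _ s0.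
apply: (@le_trans _ _ (l - c * y - `|c| * s)%:E).
  by rewrite -EFinB lee_fin lerB.
apply: (limf_einf_log_ge _ _ _ K0); exists (Num.max 0 t0) => t.
rewrite gt_max => /andP[tpos t0t]; apply: le_trans (Kt _ t0t) _.
apply: le_measure; rewrite ?inE.
- by apply: mpre => //; exact: measurable_ball.
- by apply: mpre => //; exact: open_measurable.
- by move=> w /= Zw; apply: yeO; apply: le_ball Zw; rewrite ge_min lexx.
Qed.

Lemma legendre_ge0 (y : R) : (0 <= legendre L y)%E.
Proof. by have := legendre_ge L 0 0 y L0; rewrite mul0r subr0. Qed.

(** A supremum of affine functions: a slope that beats the level [a] at [y] still beats it
    nearby. *)
Lemma lower_semicontinuous_legendre : lower_semicontinuous (legendre L).
Proof.
move=> y a /(legendre_gt _ _ _ LNy)[c [l [Lc acy]]].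
exists [set z | a < c * z - l].
  have : c * z - l @[z --> y] --> c * y - l.
    by apply: cvgB; [apply: cvgM; [exact: cvg_cst|exact: cvg_id]|exact: cvg_cst].
  by move=> /cvgr_gt; apply.
by move=> z /= acz; apply: lt_le_trans (legendre_ge _ _ _ _ Lc); rewrite lte_fin.
Qed.

(** One negative and one positive slope bound the rate from below by affine functions growing in
    opposite directions, which encloses each level set in a segment. *)
Lemma good_rate_function_legendre : good_rate_function (legendre L).
Proof.
split; first by split; [exact: legendre_ge0|exact: lower_semicontinuous_legendre].
move=> eta eta0.
have [c1 [l1 [c10 L1]]] := Lneg; have [c2 [l2 [c20 L2]]] := Lpos.
apply: (@subclosed_compact _ _ `[(eta + l1) / c1, (eta + l2) / c2]).
- rewrite [X in closed X](_ : _ = ~` [set y | (eta%:E < legendre L y)%E]).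
    apply: open_closedC.
    exact: (lower_semicontinuousP _).1 lower_semicontinuous_legendre eta.
  by apply/seteqP; split => y /=; rewrite leNgt => /negP.
- exact: segment_compact.
move=> y /= yeta; rewrite in_itv/=; apply/andP; split.
- have := le_trans (legendre_ge _ _ _ y L1) yeta; rewrite lee_fin => ?.
  by rewrite ler_ndivrMr// mulrC; lra.
- have := le_trans (legendre_ge _ _ _ y L2) yeta; rewrite lee_fin => ?.
  by rewrite ler_pdivlMr// mulrC; lra.
Qed.

(** [ldp] refers to the sigma-algebra generated by the open sets, declared as a measurable structure
    other than that of [mZ]; measurability is therefore rechecked on open sets. *)
Lemma borel_probability_law (t : R) : 0 < t -> borel_probability (law t).
Proof.
move=> t0.
have mZt : measurable_fun setT (Z t : T -> g_sigma_algebraType (@open R)).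
  apply: (@measurability _ _ _ (g_sigma_algebraType (@open R)) _ _ (@open R)
    (erefl _)) => _ [A oA <-].
  by rewrite setTI; apply: mpre => //; exact: open_measurable.
pose Zm : {mfun T >-> g_sigma_algebraType (@open R)} :=
  HB.pack (Z t : T -> g_sigma_algebraType (@open R))
    (isMeasurableFun.Build _ _ _ _ (Z t : T -> g_sigma_algebraType (@open R)) mZt).
by exists (distribution Q Zm).
Qed.

Theorem gartner_ellis :
  ldp law (fun t => t) (legendre L) /\ good_rate_function (legendre L).
Proof.
split; last exact: good_rate_function_legendre.
split.
- exact: borel_probability_law.
- exact: cvg_id.
- by split; [exact: legendre_ge0|exact: lower_semicontinuous_legendre].
- exact: limf_einf_law_ge.
- exact: limf_esup_law_le.
Qed.

End gartner_ellis.

Lemma limf_esup_eventually_le {R : realType} (f g : R -> \bar R) :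
  (exists t0, forall t, t0 < t -> f t = g t) ->
  (limf_esup f (pinfty_nbhs R) <= limf_esup g (pinfty_nbhs R))%E.
Proof.
move=> [t0 fg]; apply: le_ereal_inf_tmp => _ [V VF <-].
apply: (@le_trans _ _ (ereal_sup (f @` (V `&` [set t | t0 < t])))).
  apply: ereal_inf_lbound; exists (V `&` [set t | t0 < t]) => //.
  by apply: filterI => //; exists t0; rewrite num_real.
by apply: ge_ereal_sup => _ [t [Vt /fg ->] <-]; apply: ereal_sup_ubound; exists t.
Qed.

Lemma eq_ldp {R : realType} {Y : ptopologicalType} (pi pi' : R -> set Y -> \bar R)
    (v : R -> R) (I : Y -> \bar R) :
  (forall t A, 0 < t -> pi t A = pi' t A) -> ldp pi v I -> ldp pi' v I.
Proof.
move=> pipi [hprob hspeed hrate hopen hclosed].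
split=> //.
- by move=> t t0; have [Q hQ] := hprob t t0; exists Q => A mA; rewrite -pipi// hQ.
- move=> A oA; rewrite (le_trans (hopen A oA))// /limf_einf leeN2.
  apply: limf_esup_eventually_le; exists 0 => t t0.
  by rewrite pipi.
- move=> A cA; apply: le_trans (hclosed A cA); apply: limf_esup_eventually_le.
  by exists 0 => t t0; rewrite pipi.
Qed.

(** * The functions Lambda and tLambda *)

(** Convexity of the exponential between 0 and [x], from its tangent at [s * x] evaluated at both
    ends: the weights [s] and [1 - s] cancel the linear terms. *)
Lemma expR_ray_le {R : realType} (s x : R) : 0 <= s -> s <= 1 ->
  expR (s * x) <= s * expR x + (1 - s).
Proof.
move=> s0 s1; set E := expR (s * x).
have h1 : (1 + (1 - s) * x) * E <= expR x.
  have -> : expR x = expR ((1 - s) * x) * E by rewrite -expRD -mulrDl subrK mul1r.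
  by rewrite ler_wpM2r ?expR_ge0// expR_ge1Dx.
have h2 : (1 - s * x) * E <= 1.
  apply: (@le_trans _ _ (expR (- (s * x)) * E)); last first.
    by rewrite -expRD addNr expR0.
  by rewrite ler_wpM2r ?expR_ge0// expR_ge1Dx.
have h3 := ler_wpM2l s0 h1.
have := ler_wpM2l (_ : 0 <= 1 - s) h2; rewrite subr_ge0 => /(_ s1) h4.
nra.
Qed.

(** The truncation keeps the base nonnegative, so that the power stays continuous across the
    boundary of the domain of [tLambda], where [mu - Lambda] changes sign. *)
Lemma continuous_powR_max0 {R : realType} (nu : R) : 0 < nu ->
  continuous (fun x : R => Num.max 0 x `^ nu).
Proof.
move=> nu0 x; have [x0|x0] := ltP 0 x.
  apply: (@continuous_comp _ _ _ (fun z : R => Num.max 0 z) (fun z => z `^ nu)).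
    by apply: max_fun_continuous => y; [exact: cvg_cst|exact: cvg_id].
  apply: differentiable_continuous; apply/derivable1_diffP.
  by apply: derivable_powR; rewrite in_itv/= andbT lt_max x0 orbT.
apply/cvgrPdist_lt => e e0 /=; rewrite (max_l x0) powR0 ?gt_eqF//.
have d0 : 0 < e `^ nu^-1 by exact: powR_gt0.
near=> z; rewrite sub0r normrN ger0_norm ?powR_ge0//.
have [z0|z0] := leP z 0; first by rewrite powR0 ?gt_eqF.
rewrite [ltRHS](_ : _ = (e `^ nu^-1) `^ nu); last first.
  by rewrite -powRrM mulVf ?gt_eqF// powRr1// ltW.
apply: gt0_ltr_powR => //; rewrite ?nnegrE ?(ltW z0) ?(ltW d0)//.
by near: z; apply: (cvgr_lt x); [exact: cvg_id|exact: le_lt_trans x0 d0].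
Unshelve. all: by end_near. Qed.

Lemma derivable1_comp {R : realType} (f g : R -> R) (x : R) :
  derivable f (g x) 1 -> derivable g x 1 -> derivable (f \o g) x 1.
Proof.
move=> /derivableP df /derivableP dg.
exact: (@ex_derive _ _ _ _ _ _ _ (is_derive1_comp df dg)).
Qed.

Section Lambda_analysis.
Context {R : realType} (a1 a2 b1 b2 : R).
Hypotheses (a10 : 0 < a1) (a20 : 0 < a2) (b10 : 0 < b1) (b20 : 0 < b2).

(** Discriminant of the characteristic polynomial of the 2 x 2 matrix with diagonal [-(a1 + a2)],
    [-(b1 + b2)] and off-diagonal entries [a1 * expR c + a2 * expR (- c)],
    [b1 * expR c + b2 * expR (- c)]; [Lambda] is the larger root. *)
Definition Lambda_disc (c : R) : R := (a1 + a2 - (b1 + b2)) ^+ 2 +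
  4 * (a1 * expR c + a2 * expR (- c)) * (b1 * expR c + b2 * expR (- c)).

Let disc := Lambda_disc.
Let L := Lambda a1 a2 b1 b2.
Let w := a1 + a2 + b1 + b2.

Lemma Lambda_disc_gt0 (c : R) : 0 < disc c.
Proof.
rewrite /disc /Lambda_disc ltr_wpDl ?sqr_ge0//.
by rewrite !mulr_gt0// addr_gt0// mulr_gt0// expR_gt0.
Qed.

Lemma LambdaE (c : R) : L c = (Num.sqrt (disc c) - w) / 2.
Proof.
rewrite /L /Lambda /h /w.
have E0 := expR_gt0 c.
set X := (X in Num.sqrt X).
have -> : X = expR c ^+ 2 * disc c.
  rewrite /X /disc /Lambda_disc expRN; field; rewrite gt_eqF//.
rewrite sqrtrM ?sqr_ge0// sqrtr_sqr gtr0_norm//; field; rewrite gt_eqF//.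
Qed.

Lemma Lambda_disc0 : disc 0 = w ^+ 2.
Proof. rewrite /disc /Lambda_disc oppr0 expR0 /w; ring. Qed.

Lemma Lambda0 : L 0 = 0.
Proof.
rewrite LambdaE Lambda_disc0 sqrtr_sqr ger0_norm ?subrr ?mul0r//.
by rewrite /w !addr_ge0// ltW.
Qed.

(** Up to a constant, a positive combination of exponentials of [2 * c] and [- 2 * c]: both
    convexity and growth at the two ends can be read off. *)
Lemma Lambda_discE (c : R) :
  disc c = 4 * a1 * b1 * expR (2 * c) + 4 * a2 * b2 * expR (2 * - c)
    + ((a1 + a2 - (b1 + b2)) ^+ 2 + 4 * (a1 * b2 + a2 * b1)).
Proof.
rewrite !(mulr_natl _ 2) !mulr2n !expRD /disc /Lambda_disc expRN.
have := gt_eqF (expR_gt0 c); move: (expR c) => E /negbT E0; field.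
exact: E0.
Qed.

Lemma Lambda_disc_ray (s c : R) : 0 <= s -> s <= 1 ->
  disc (s * c) <= s * disc c + (1 - s) * disc 0.
Proof.
move=> s0 s1; rewrite !Lambda_discE oppr0 mulr0 expR0.
have h1 := expR_ray_le s (2 * c) s0 s1; have h2 := expR_ray_le s (2 * - c) s0 s1.
rewrite -mulrN !(mulrCA 2 s) in h1 h2 *.
have p1 : 0 <= 4 * a1 * b1 by rewrite !mulr_ge0// ltW.
have p2 : 0 <= 4 * a2 * b2 by rewrite !mulr_ge0// ltW.
have := ler_wpM2l p1 h1; have := ler_wpM2l p2 h2; lra.
Qed.

(* The convexity of Lambda, in the only form needed: Lambda leaves the level mu
   with nonzero slope. *)
Lemma Lambda_ray_gap (mu c : R) : 0 < mu -> L c = mu ->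
  exists2 k, 0 < k & forall s, 0 <= s -> s <= 1 -> (1 - s) * k <= mu - L (s * c).
Proof.
move=> mu0 Lc; set v := Num.sqrt (disc c).
have vE : v = w + 2 * mu by move: Lc; rewrite LambdaE -/v; lra.
have w0 : 0 < w by rewrite /w !addr_gt0.
have v0 : 0 < v by rewrite vE; lra.
have v2 : v ^+ 2 = disc c by rewrite sqr_sqrtr// ltW// Lambda_disc_gt0.
(* Convexity of the discriminant gives [v ^+ 2 - r ^+ 2 >= (1 - s) * (v ^+ 2 - w ^+ 2)] for the root
   [r] at [s * c]. Dividing by [v + r <= 2 * v] bounds [v - r], and [Lambda] contains half of the
   root. *)
exists ((v ^+ 2 - w ^+ 2) / (4 * v)).
  rewrite divr_gt0 ?mulr_gt0// subr_gt0 ltr_pXn2r ?nnegrE ?ltW//.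
  by rewrite vE; lra.
move=> s s0 s1; have := Lambda_disc_ray s c s0 s1.
rewrite Lambda_disc0 -v2 LambdaE; set r := Num.sqrt (disc (s * c)).
have r0 : 0 <= r by exact: sqrtr_ge0.
have -> : disc (s * c) = r ^+ 2 by rewrite sqr_sqrtr// ltW// Lambda_disc_gt0.
move=> rv.
rewrite mulrA ler_pdivrMr ?mulr_gt0//.
have wv : w ^+ 2 <= v ^+ 2 by rewrite ler_pXn2r ?nnegrE ?ltW// vE; lra.
have rv1 : r <= v.
  rewrite -(ler_pXn2r (_ : (0 < 2)%N)) ?nnegrE ?(ltW v0)//; nra.
have -> : mu = (v - w) / 2 by rewrite vE; lra.
nra.
Qed.

Lemma derivable_Lambda (c : R) : derivable L c 1.
Proof.
have -> : L = fun x => (Num.sqrt (disc x) - w) / 2.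
  by apply/funext => x; exact: LambdaE.
have dN : derivable (fun x : R => expR (- x)) c 1.
  by apply: (@derivable1_comp _ expR (fun x => - x)).
have dpq (q r : R) : derivable (fun x : R => q * expR x + r * expR (- x)) c 1.
  apply: (@derivableD _ _ _ (fun x => q * expR x) (fun x => r * expR (- x))).
    exact: (@derivableM _ _ (cst q) expR).
  exact: (@derivableM _ _ (cst r) (fun x => expR (- x))).
have dd : derivable disc c 1.
  apply: (@derivableD _ _ _ (cst ((a1 + a2 - (b1 + b2)) ^+ 2)) (fun x =>
    4 * (a1 * expR x + a2 * expR (- x)) * (b1 * expR x + b2 * expR (- x)))).
    exact: derivable_cst.
  apply: (@derivableM _ _ (fun x => 4 * (a1 * expR x + a2 * expR (- x)))); last exact: dpq.
  by apply: (@derivableM _ _ (cst 4)); [exact: derivable_cst|exact: dpq].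
apply: (@derivableM _ _ (fun x => Num.sqrt (disc x) - w) (cst 2^-1)) => //.
apply: (@derivableB _ _ _ (fun x => Num.sqrt (disc x)) (cst w)) => //.
apply: (@derivable1_comp _ Num.sqrt disc) => //.
by have [] := is_derive1_sqrt (Lambda_disc_gt0 c).
Qed.

Lemma continuous_Lambda : continuous L.
Proof.
move=> c; apply: differentiable_continuous; apply/derivable1_diffP.
exact: derivable_Lambda.
Qed.

Lemma Lambda_bounded_sublevel (m : R) :
  exists M, forall c, L c <= m -> `|c| <= M.
Proof.
pose v := `|w + 2 * m| ^+ 2.
(* Each exponential term of the discriminant alone is at most [v]; with [1 + x <= expR x], the
   coefficient 4 and the exponent [2 * c] combine to 8. *)
exists (v / (8 * a1 * b1) + v / (8 * a2 * b2)) => c.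
rewrite LambdaE => cm.
have {}cm : disc c <= v.
  have <- : Num.sqrt (disc c) ^+ 2 = disc c.
    by rewrite sqr_sqrtr// ltW// Lambda_disc_gt0.
  rewrite /v ler_pXn2r ?nnegrE ?sqrtr_ge0//.
  by apply: le_trans (ler_norm _); lra.
have p1 : 0 < 8 * a1 * b1 by rewrite !mulr_gt0.
have p2 : 0 < 8 * a2 * b2 by rewrite !mulr_gt0.
have v0 : 0 <= v by rewrite /v exprn_ge0.
have K0 : 0 <= (a1 + a2 - (b1 + b2)) ^+ 2 + 4 * (a1 * b2 + a2 * b1).
  by rewrite addr_ge0 ?sqr_ge0// mulr_ge0// addr_ge0// mulr_ge0// ltW.
rewrite Lambda_discE in cm.
have e1 := expR_ge1Dx (2 * c); have e2 := expR_ge1Dx (2 * - c).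
have e10 := expR_ge0 (2 * c); have e20 := expR_ge0 (2 * - c).
have c1 : c <= v / (8 * a1 * b1) by rewrite ler_pdivlMr//; nra.
have c2 : - c <= v / (8 * a2 * b2) by rewrite ler_pdivlMr//; nra.
have v1 : 0 <= v / (8 * a1 * b1) by rewrite divr_ge0// ltW.
have v2 : 0 <= v / (8 * a2 * b2) by rewrite divr_ge0// ltW.
by rewrite ler_norml; apply/andP; split; lra.
Qed.

(** * Steepness of the tempered exponent *)

Section tempered.
Variables nu mu : R.
Hypotheses (nu0 : 0 < nu) (nu1 : nu < 1) (mu0 : 0 < mu).

Let tL := tLambda a1 a2 b1 b2 nu mu.

Lemma tLambda_fin (c : R) : L c <= mu ->
  tL c = (mu `^ nu - (mu - L c) `^ nu)%:E.
Proof. by rewrite /tL /tLambda -/(L c) => ->. Qed.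

Lemma tLambda_finP (c l : R) : tL c = l%:E ->
  L c <= mu /\ l = mu `^ nu - (mu - L c) `^ nu.
Proof. by rewrite /tL /tLambda -/(L c); case: ifP => // _ [->]. Qed.

Lemma tLambdaNy (c : R) : tL c != -oo%E.
Proof. by rewrite /tL /tLambda; case: ifP. Qed.

Lemma tLambda0 : tL 0 = 0%E.
Proof. by rewrite tLambda_fin Lambda0 ?subr0 ?subrr// ltW. Qed.

Lemma near_Lambda_lt (c : R) : L c < mu -> \forall x \near c, L x < mu.
Proof. by move=> cmu; have /cvgr_lt := continuous_Lambda c; apply. Qed.

Lemma tLambda_fin_near0 : exists2 e : R, 0 < e &
  (exists l, tL e = l%:E) /\ exists l, tL (- e) = l%:E.
Proof.
have [/= e e0 eL] : \forall x \near (0 : R), L x < mu.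
  by apply: near_Lambda_lt; rewrite Lambda0.
have e2 : `|e / 2| < e by rewrite gtr0_norm ?divr_gt0//; lra.
exists (e / 2); first by rewrite divr_gt0.
split; eexists; apply: tLambda_fin; apply: ltW; apply: eL => /=.
  by rewrite sub0r normrN.
by rewrite sub0r opprK.
Qed.

(** The infinite slope of the power [nu < 1] at 0, in the form that excludes a maximum on the
    boundary of the domain. *)
Lemma powR_lt_linear_absurd (k B : R) : 0 < k -> 0 <= B ->
  ~ (forall e, 0 < e -> e <= 1 -> (e * k) `^ nu <= e * B).
Proof.
move=> k0 B0 abs; have kn : 0 < k `^ nu by exact: powR_gt0.
have B1 : 0 < B + 1 by rewrite ltr_wpDl.
have n1 : 0 < 1 - nu by rewrite subr_gt0.
have q0 : 0 < k `^ nu / (B + 1) by rewrite divr_gt0.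
pose e := Num.min 1 ((k `^ nu / (B + 1)) `^ (1 - nu)^-1).
have e0 : 0 < e by rewrite lt_min ltr01 powR_gt0.
have en : 0 < e `^ nu by exact: powR_gt0.
have eq : e `^ (1 - nu) <= k `^ nu / (B + 1).
  rewrite [leRHS](_ : _ = ((k `^ nu / (B + 1)) `^ (1 - nu)^-1) `^ (1 - nu)); last first.
    by rewrite -powRrM mulVf ?gt_eqF// powRr1// ltW.
  by apply: ge0_ler_powR; rewrite ?nnegrE ?powR_ge0 ?ge_min ?lexx ?orbT// ltW.
have := abs e e0; rewrite ge_min lexx => /(_ isT).
have -> : e * B = e `^ nu * (e `^ (1 - nu) * B).
  rewrite mulrA -powRD; last by apply/implyP => _; rewrite gt_eqF.
  by rewrite (addrC nu) subrK powRr1// ltW.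
rewrite powRM ?(ltW e0) ?(ltW k0)// ler_pM2l// => kB.
have : k `^ nu <= k `^ nu / (B + 1) * B by apply: le_trans kB _; rewrite ler_wpM2r.
rewrite -mulrA ler_pMr// ler_pdivlMl//; lra.
Qed.

(* Steepness: at a boundary point of the domain the slope is infinite, so the
   maximum of c * y - tL c is attained in the interior. *)
Lemma tLambda_maximizer (y : R) : exists2 c, L c < mu & forall x, L x <= mu ->
  x * y + (mu - L x) `^ nu <= c * y + (mu - L c) `^ nu.
Proof.
pose D := [set c | L c <= mu].
(* A globally continuous function that agrees on [D] with the one to be maximized. *)
pose F x := x * y + Num.max 0 (mu - L x) `^ nu.
have FE x : L x <= mu -> F x = x * y + (mu - L x) `^ nu.
  by move=> xmu; rewrite /F max_r// subr_ge0.
have cF : continuous F.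
  move=> x; apply: cvgD; first by apply: cvgM; [exact: cvg_id|exact: cvg_cst].
  apply: (@continuous_comp _ _ _ (fun z => mu - L z)
    (fun z => Num.max 0 z `^ nu)); last exact: continuous_powR_max0.
  by apply: cvgB; [exact: cvg_cst|exact: continuous_Lambda].
have D0 : D 0 by rewrite /D/= Lambda0 ltW.
have cD : compact D.
  have [M LM] := Lambda_bounded_sublevel mu.
  apply: (@subclosed_compact _ _ `[- M, M]).
  - apply: (@closed_comp _ _ L [set x | x <= mu]); last exact: closed_le.
    by move=> x _; exact: continuous_Lambda.
  - exact: segment_compact.
  - by move=> c /LM; rewrite ler_norml /= in_itv.
have [|c /set_mem cmu cmax] := compact_EVT_max (ex_intro _ 0 D0) cD (f := F).
  exact: continuous_subspaceT.
have {}cmax x : L x <= mu -> F x <= F c by move=> xmu; apply: cmax; rewrite inE.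
exists c; last by move=> x xmu; rewrite -!FE//; exact: cmax.
rewrite lt_neqAle [X in _ && X]cmu andbT; apply/eqP => Lc.
have [k k0 gap] := Lambda_ray_gap mu c mu0 Lc.
apply: (powR_lt_linear_absurd k `|c * y| k0 (normr_ge0 _)) => e e0 e1.
have g := gap (1 - e); rewrite subr_ge0 gerBl subKr e1 (ltW e0) in g.
have {}g := g isT isT.
have ek : 0 <= e * k by rewrite mulr_ge0// ltW.
have emu : L ((1 - e) * c) <= mu by rewrite -subr_ge0 (le_trans ek g).
have := cmax _ emu; rewrite !FE// Lc subrr powR0 ?gt_eqF// addr0.
rewrite -lerBrDl => h; apply: le_trans (le_trans h _).
  by apply: ge0_ler_powR => //; rewrite ?nnegrE ?(ltW nu0)// subr_ge0.
have -> : c * y - (1 - e) * c * y = e * (c * y) by ring.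
by rewrite ler_pM2l// ler_norm.
Qed.

Lemma tLambda_derive (y : R) : exists (c : R) (l : R -> R),
  (\forall x \near c, tL x = (l x)%:E) /\ is_derive c 1 l y.
Proof.
have [c cmu cmax] := tLambda_maximizer y.
pose l x := mu `^ nu - (mu - L x) `^ nu.
exists c, l; split.
  by apply: filterS (near_Lambda_lt c cmu) => x /ltW; exact: tLambda_fin.
have [/= r r0 rL] := near_Lambda_lt c cmu.
have dl x : L x < mu -> derivable (fun z => (mu - L z) `^ nu) x 1.
  move=> xmu; apply: (@derivable1_comp _ (fun z => z `^ nu) (fun z => mu - L z)).
    by apply: derivable_powR; rewrite in_itv/= andbT subr_gt0.
  by apply: derivableB => //; exact: derivable_Lambda.
have rx x : x \in `](c - r), (c + r)[ -> L x < mu.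
  rewrite in_itv/= => /andP[? ?]; apply: rL => /=.
  by rewrite ltr_norml; apply/andP; split; lra.
pose G x := x * y + (mu - L x) `^ nu.
have dF : is_derive c 1 G 0.
  apply: (@derive1_at_max _ _ (c - r) (c + r)).
  - by lra.
  - move=> x /rx xmu; apply: derivableD; first exact: derivableM.
    exact: dl.
  - by rewrite in_itv/=; apply/andP; split; lra.
  - by move=> x /rx/ltW; exact: cmax.
have -> : l = cst (mu `^ nu) + ((fun x => x * y) - G).
  by apply/funext => x; rewrite /l /G !fctE; ring.
have dy : is_derive c 1 (fun x : R => x * y) y.
  have := is_deriveM (is_derive_id c 1) (is_derive_cst y c 1).
  by rewrite scaler0 add0r [y *: 1]mulr1.
have dB : is_derive c 1 ((fun x => x * y) - G) (y - 0) by exact: is_deriveB dy dF.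
have := is_deriveD (is_derive_cst (mu `^ nu) c 1) dB.
by rewrite add0r subr0.
Qed.

End tempered.

End Lambda_analysis.

(** * Birth-death chains with bounded rates *)

Section esum_int.
Context {R : realType}.
Local Open Scope ereal_scope.

Lemma esum_peel {I : choiceType} (x : I) (D : set I) (f : I -> \bar R) :
  D x -> (forall i, 0 <= f i) ->
  \esum_(i in D) f i = f x + \esum_(i in D `\ x) f i.
Proof.
move=> Dx f0; rewrite (esumID [set x])//.
have -> : D `&` [set x] = [set x].
  by apply/seteqP; split => [y []//|y ->]; split.
by rewrite esum_set1.
Qed.

(** The enumeration 0, -1, 1, -2, ... turns sums over the integers into series, which can be
    interchanged with each other and with integrals. *)
Definition int_enum (i : nat) : int := if odd i then Negz i./2 else Posz i./2.

Lemma int_enum_bij : set_bij setT setT int_enum.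
Proof.
split => //.
- move=> i j _ _; rewrite /int_enum => ij.
  rewrite -(odd_double_half i) -(odd_double_half j); move: ij.
  by case: (odd i); case: (odd j) => // -[->].
- case=> n _.
    by exists n.*2 => //; rewrite /int_enum odd_double doubleK.
  by exists n.*2.+1 => //; rewrite /int_enum /= odd_double /= uphalf_double.
Qed.

Lemma esum_int (f : int -> \bar R) : (forall n, 0 <= f n) ->
  \esum_(n in [set: int]) f n = \sum_(0 <= i <oo) f (int_enum i).
Proof.
by move=> f0; rewrite nneseries_esumT// (reindex_esum _ _ _ _ int_enum_bij).
Qed.

End esum_int.

Section derivative_comparison.
Context {R : realType}.

(** Both [g + f] and [g - f] are nondecreasing. This replaces integration in the Taylor estimate
    below. *)
Lemma derive_abs_le (f g f' g' : R -> R) (b : R) :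
  {within `[0, b], continuous f} -> {within `[0, b], continuous g} ->
  (forall t, 0 < t < b -> is_derive t 1 f (f' t)) ->
  (forall t, 0 < t < b -> is_derive t 1 g (g' t)) ->
  (forall t, 0 < t < b -> `|f' t| <= g' t) ->
  f 0 = 0 -> 0 <= g 0 -> forall t, 0 <= t <= b -> `|f t| <= g t.
Proof.
move=> cf cg df dg fg f0 g0 t /andP[t0 tb].
have nd (h h' : R -> R) : {within `[0, b], continuous h} ->
    (forall t, 0 < t < b -> is_derive t 1 h (h' t)) ->
    (forall t, 0 < t < b -> 0 <= h' t) -> h 0 <= h t.
  move=> ch dh h0; apply: (@ger0_derive1_ndecr R h 0 b) => // x.
    by rewrite in_itv/= => /dh[].
  by rewrite in_itv/= derive1E => x0b; rewrite (@derive_val _ _ _ _ _ _ _ (dh x x0b)) h0.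
rewrite ler_norml; apply/andP; split.
- rewrite -subr_ge0 opprK; apply: (@le_trans _ _ (f 0 + g 0)); first by rewrite f0 add0r.
  apply: (nd (f \+ g) (fun x => f' x + g' x)).
  + by move=> x; apply: cvgD; [exact: cf|exact: cg].
  + by move=> x xb; apply: is_deriveD; [exact: df|exact: dg].
  + by move=> x /fg; rewrite ler_norml => /andP[? _]; lra.
- rewrite -subr_ge0; apply: (@le_trans _ _ (g 0 - f 0)); first by rewrite f0 subr0.
  apply: (nd (g \- f) (fun x => g' x - f' x)).
  + by move=> x; apply: cvgB; [exact: cg|exact: cf].
  + by move=> x xb; apply: is_deriveB; [exact: dg|exact: df].
  + by move=> x /fg; rewrite ler_norml => /andP[_ ?]; lra.
Qed.

End derivative_comparison.

(** * Backward equation and uniformization *)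

Section birth_death.
Context {R : realType} (p : R -> int -> int -> R) (u d : int -> R) (c : R).
Hypothesis ptr : transition_function p.
Hypothesis gen : has_generator p (fun k n =>
  if n == k + 1 then u k else if n == k - 1 then d k
  else if n == k then - (u k + d k) else 0).
Hypotheses (u0 : forall k, 0 <= u k) (d0 : forall k, 0 <= d k)
  (udc : forall k, u k + d k <= c).

Let p0 (t : R) k n : 0 <= t -> 0 <= p t k n.
Proof. by move=> t0; exact: (transition_ge0 ptr). Qed.

Lemma int_succ_neq (k : int) :
  [/\ k + 1 != k, k - 1 != k & k - 1 != k + 1].
Proof. by split; lia. Qed.

Let rest (k : int) : set int := [set: int] `\ k `\ (k + 1) `\ (k - 1).

Lemma esum_peel3 (k : int) (f : int -> \bar R) : (forall i, 0 <= f i)%E ->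
  (\esum_(i in [set: int]) f i =
    f k + (f (k + 1)%R + (f (k - 1)%R + \esum_(i in rest k) f i)))%E.
Proof.
have [k1 k2 k3] := int_succ_neq k.
move=> f0; rewrite (esum_peel k)// (esum_peel (k + 1))//; last first.
  by split => //=; apply/eqP.
rewrite (esum_peel (k - 1))//.
by split=> /=; [split => //=; apply/eqP|apply/eqP].
Qed.

Let defect (s : R) (k : int) : R :=
  1 - (p s k k + p s k (k + 1) + p s k (k - 1)).

Let step (s t : R) (k n : int) : R :=
  p s k k * p t k n + p s k (k + 1) * p t (k + 1) n + p s k (k - 1) * p t (k - 1) n.

Lemma esum_rest_defect (s : R) (k : int) : 0 <= s ->
  (\esum_(i in rest k) (p s k i)%:E = (defect s k)%:E)%E.
Proof.
move=> s0; have := transition_sum1 ptr k s0.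
rewrite (esum_peel3 k); last by move=> i; rewrite lee_fin p0.
rewrite !addeA -!EFinD; case: (\esum_(i in rest k) _)%E => [r| |]//.
by rewrite -EFinD => -[rE]; congr (_%:E); rewrite /defect; lra.
Qed.

Lemma transition_le1 (t : R) (k n : int) : 0 <= t -> p t k n <= 1.
Proof.
move=> t0; rewrite -lee_fin -(transition_sum1 ptr k t0).
rewrite (esum_peel n)//; last by move=> i; rewrite lee_fin p0.
by rewrite leeDl// esum_ge0// => i _; rewrite lee_fin p0.
Qed.

(** Intermediate states other than [k] and its neighbours contribute between 0 and their total mass,
    since transition probabilities are at most 1. This avoids differentiating an infinite sum. *)
Lemma chapman_kolmogorov_step (s t : R) (k n : int) : 0 <= s -> 0 <= t ->
  step s t k n <= p (s + t) k n <= step s t k n + defect s k.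
Proof.
move=> s0 t0; have := chapman_kolmogorov ptr k n s0 t0.
rewrite (esum_peel3 k); last by move=> i; rewrite lee_fin mulr_ge0 ?p0.
set r := (\esum_(i in rest k) _)%E.
have r0 : (0 <= r)%E by apply: esum_ge0 => i _; rewrite lee_fin mulr_ge0 ?p0.
have rd : (r <= (defect s k)%:E)%E.
  rewrite -esum_rest_defect//; apply: le_esum => i _.
  by rewrite lee_fin ler_piMr ?p0// transition_le1.
rewrite !addeA -!EFinD -/(step s t k n).
case: r r0 rd => [r| |]//; rewrite !lee_fin => r0 rd [<-].
by rewrite lerDl lerD2l r0.
Qed.

(** Conditioning on the state at time [s], the state [k] reproduces [p t k n] with weight [p s k k],
    and the remaining mass moves the value by at most [1 - p s k k]. The bound is uniform in [t],
    whence continuity in time. *)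
Lemma transition_increment (s t : R) (k n : int) : 0 <= s -> 0 <= t ->
  `|p (s + t) k n - p t k n| <= 1 - p s k k.
Proof.
move=> s0 t0; have /andP[] := chapman_kolmogorov_step s t k n s0 t0.
rewrite /defect /step.
have := p0 s k k s0; have := transition_le1 s k k s0.
have := p0 t k n t0; have := transition_le1 t k n t0.
have := p0 s k (k + 1) s0; have := transition_le1 t (k + 1) n t0.
have := p0 s k (k - 1) s0; have := transition_le1 t (k - 1) n t0.
have := p0 t (k + 1) n t0; have := p0 t (k - 1) n t0.
move: (p s k k) (p s k (k + 1)) (p s k (k - 1)) (p t k n) (p t (k + 1) n)
  (p t (k - 1) n) (p (s + t) k n) => x1 x2 x3 y1 y2 y3 z.
by move=> *; rewrite ler_norml; apply/andP; split; nra.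
Qed.

(* Extends the transition function continuously to negative times. *)
Let F (k n : int) (t : R) : R := p (Num.max 0 t) k n.

Let FE k n t : 0 <= t -> F k n t = p t k n.
Proof. by move=> t0; rewrite /F max_r. Qed.

Lemma rate_diag (k : int) : (p t k k - 1) / t @[t --> 0^'+] --> - (u k + d k).
Proof.
have := gen k k; rewrite transition_init// eqxx.
have [/negbTE k1 /negbTE k2 _] := int_succ_neq k.
by rewrite eq_sym k1 eq_sym k2.
Qed.

Lemma rate_up (k : int) : p t k (k + 1) / t @[t --> 0^'+] --> u k.
Proof.
have := gen k (k + 1); rewrite transition_init// eqxx.
have [/negbTE k1 _ _] := int_succ_neq k; rewrite eq_sym k1.
by under eq_fun do rewrite subr0.
Qed.

Lemma rate_down (k : int) : p t k (k - 1) / t @[t --> 0^'+] --> d k.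
Proof.
have := gen k (k - 1); rewrite transition_init// eqxx.
have [_ /negbTE k2 /negbTE k3] := int_succ_neq k; rewrite eq_sym k2 k3.
by under eq_fun do rewrite subr0.
Qed.

(* The rates of a row sum to zero, so the chance of leaving the three nearest
   sites is o(t). *)
Lemma rate_defect (k : int) : defect t k / t @[t --> 0^'+] --> 0.
Proof.
have e0 : - (- (u k + d k) + u k + d k) = 0 by ring.
suff : defect t k / t @[t --> 0^'+] --> - (- (u k + d k) + u k + d k) by rewrite e0.
have -> : (fun t => defect t k / t) = (fun t =>
    - ((p t k k - 1) / t + p t k (k + 1) / t + p t k (k - 1) / t)).
  by apply/funext => t; rewrite /defect; ring.
by apply: cvgN; apply: cvgD; [apply: cvgD|]; [exact: rate_diag|exact: rate_up|
  exact: rate_down].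
Qed.

Lemma transition_diag_cvg1 (k : int) : 1 - p t k k @[t --> 0^'+] --> 0.
Proof.
have id0 : (t : R) @[t --> 0^'+] --> (0 : R).
  by apply: cvg_within_filter; exact: cvg_id.
suff : 1 - p t k k @[t --> 0^'+] --> 0 * - - (u k + d k) by rewrite mul0r.
have h : t * - ((p t k k - 1) / t) @[t --> 0^'+] --> 0 * - - (u k + d k).
  by apply: cvgM => //; apply: cvgN; exact: rate_diag.
apply: cvg_trans h; apply: near_eq_cvg; near=> t.
have t0 : 0 < t by near: t; exact: nbhs_right_gt.
by rewrite -mulNr mulrCA mulfV ?gt_eqF// mulr1 opprB.
Unshelve. all: by end_near. Qed.

Lemma continuous_transition (k n : int) : continuous (F k n).
Proof.
move=> x; apply/cvgrPdist_lt => e e0.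
have /cvgrPdist_lt/(_ _ e0) := transition_diag_cvg1 k.
rewrite near_withinE => -[/= r r0 re].
have close (y z : R) : 0 <= y -> y <= z -> z - y < r -> `|p z k n - p y k n| < e.
  move=> y0; rewrite le_eqVlt => /predU1P[->|yz] zyr; first by rewrite subrr normr0.
  have zy0 : 0 < z - y by rewrite subr_gt0.
  rewrite -{1}(subrK y z); apply: le_lt_trans (transition_increment _ _ _ _ (ltW zy0) y0) _.
  have := re (z - y); rewrite /ball_/= !sub0r !normrN (gtr0_norm zy0).
  by move=> /(_ zyr zy0); apply: le_lt_trans; exact: ler_norm.
exists r => //= y; rewrite /ball_/= /F => xyr.
have maxr : `|Num.max 0 x - Num.max 0 y| < r.
  apply: le_lt_trans xyr; case: (leP 0 x) => x0; case: (leP 0 y) => y0.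
  - by [].
  - by rewrite subr0 ger0_norm// ler_normr; apply/orP; left; lra.
  - by rewrite sub0r normrN ger0_norm// ler_normr; apply/orP; right; lra.
  - by rewrite subrr normr0.
have mx : 0 <= Num.max 0 x by rewrite le_max lexx.
have my : 0 <= Num.max 0 y by rewrite le_max lexx.
case: (leP (Num.max 0 x) (Num.max 0 y)) => xy.
- by rewrite distrC; apply: close => //; rewrite distrC ger0_norm ?subr_ge0// in maxr.
- apply: close => //; first exact: ltW.
  by rewrite gtr0_norm ?subr_gt0// in maxr.
Qed.

Let B (k n : int) (t : R) : R :=
  u k * F (k + 1) n t + d k * F (k - 1) n t - (u k + d k) * F k n t.

(** Kolmogorov's backward equation: the difference quotient is squeezed between [low] and [low] plus
    a defect that tends to 0. *)
Lemma is_derive_transition (k n : int) (t : R) : 0 < t ->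
  is_derive t 1 (F k n) (B k n t).
Proof.
move=> t0.
have absr : (`|h|) @[h --> (0:R)^'] --> (0:R)^'+.
  move=> A [/= r r0 rA]; exists r => //= h; rewrite /ball_/= sub0r normrN => hr h0.
  by apply: rA => /=; rewrite /ball_/= ?sub0r ?normrN ?normr_id// normr_gt0.
(* [t + Num.min 0 h] is the earlier of [t] and [t + h]. From this base point the quotient is a
   forward one of duration [|h|] for both signs of [h]; the base point moves when [h < 0], which is
   where continuity enters. *)
have m0 : t + Num.min 0 h @[h --> (0:R)^'] --> t.
  have /cvg_within_filter h : t + Num.min 0 h @[h --> (0:R)] --> t + Num.min 0 (0:R).
    apply: cvgD; first exact: cvg_cst.
    by apply: min_fun_continuous => y; [exact: cvg_cst|exact: cvg_id].
  by have := h (fun x => x != 0); rewrite min_l// addr0.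
have Fm j : F j n (t + Num.min 0 h) @[h --> (0:R)^'] --> F j n t.
  exact: (cvg_comp _ _ m0 (continuous_transition j n t)).
pose low h := (p `|h| k k - 1) / `|h| * F k n (t + Num.min 0 h)
  + p `|h| k (k + 1) / `|h| * F (k + 1) n (t + Num.min 0 h)
  + p `|h| k (k - 1) / `|h| * F (k - 1) n (t + Num.min 0 h).
have lowB : low h @[h --> (0:R)^'] --> B k n t.
  have -> : B k n t = - (u k + d k) * F k n t + u k * F (k + 1) n t + d k * F (k - 1) n t.
    by rewrite /B; ring.
  apply: cvgD; [apply: cvgD|]; (apply: cvgM; last exact: Fm).
  - exact: (cvg_comp _ _ absr (rate_diag k)).
  - exact: (cvg_comp _ _ absr (rate_up k)).
  - exact: (cvg_comp _ _ absr (rate_down k)).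
have highB : low h + defect `|h| k / `|h| @[h --> (0:R)^'] --> B k n t.
  rewrite -[B k n t]addr0; apply: cvgD => //.
  exact: (cvg_comp _ _ absr (rate_defect k)).
have dF : h^-1 *: ((F k n \o shift t) (h *: 1) - F k n t) @[h --> (0:R)^'] --> B k n t.
  apply: squeeze_cvgr lowB highB; near=> h.
  have h0 : h != 0 by near: h; exact: nbhs_dnbhs_neq.
  have hn0 : 0 < `|h| by rewrite normr_gt0.
  have ht : `|h| < t.
    near: h; exists t => //= h; rewrite /ball_/= sub0r normrN => + _; exact.
  have /= -> : h^-1 *: (F k n (h *: 1 + t) - F k n t) =
      (p (`|h| + (t + Num.min 0 h)) k n - p (t + Num.min 0 h) k n) / `|h|.
    rewrite [h *: 1]mulr1 [_ *: _]mulrC.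
    move: ht; case: (ltgtP h 0) h0 => // h0 _ ht.
      rewrite ltr0_norm// in ht *; rewrite [F _ _ t]FE ?(ltW t0)// FE; last by lra.
      rewrite (_ : - h + (t + h) = t); last by ring.
      by rewrite invrN mulrN -mulNr opprB (addrC h).
    by rewrite gtr0_norm// addr0 !FE ?(ltW t0)// addr_ge0// ltW.
  set m := t + Num.min 0 h.
  have m_ge0 : 0 <= m.
    rewrite /m; case: (ltP h 0) => h1; last by rewrite addr0 ltW.
    by move: ht; rewrite ltr0_norm//; lra.
  have := chapman_kolmogorov_step `|h| m k n (ltW hn0) m_ge0.
  have -> : low h = (step `|h| m k n - p m k n) / `|h|.
    by rewrite /low -/m !FE// /step; field; rewrite gt_eqF.
  rewrite -mulrDl !ler_pM2r ?invr_gt0// => /andP[h1 h2].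
  by apply/andP; split; lra.
apply: DeriveDef; first by apply/cvg_ex; exists (B k n t).
exact: cvg_lim dF.
Unshelve. all: by end_near. Qed.

(* [jump_weight m k n] is the entry (k, n) of the m-th power of c + generator,
   so that the transition matrix is the exponential series expR (- c t) times
   the sum of t ^ m / m! * jump_weight m. *)
Fixpoint jump_weight (m : nat) (k n : int) : R :=
  if m is m'.+1 then u k * jump_weight m' (k + 1) n
    + d k * jump_weight m' (k - 1) n + (c - u k - d k) * jump_weight m' k n
  else (k == n)%:R.

Lemma jump_weight_ge0 (m : nat) (k n : int) : 0 <= jump_weight m k n.
Proof.
elim: m k => [|m IH] k /=; first by rewrite ler0n.
have := udc k; have := u0 k; have := d0 k.
by move=> *; rewrite !addr_ge0// mulr_ge0//; lra.
Qed.

(** The factor [expR (c * t)] turns the backward equation into a system whose coefficients are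
    nonnegative and sum to [c] in each row. *)
Let W (k n : int) (t : R) : R := expR (c * t) * F k n t.

Let poly (m : nat) (k n : int) (t : R) : R :=
  \sum_(j < m) t ^+ j / j`!%:R * jump_weight j k n.

Lemma is_derive_weighted (k n : int) (t : R) : 0 < t -> is_derive t 1 (W k n)
  (u k * W (k + 1) n t + d k * W (k - 1) n t + (c - u k - d k) * W k n t).
Proof.
move=> t0.
have dc : is_derive t 1 (fun t : R => c * t) c.
  have := is_deriveM (is_derive_cst c t 1) (is_derive_id t 1).
  by rewrite scaler0 addr0 [c *: 1]mulr1.
have dexp : is_derive t 1 (fun t => expR (c * t)) (expR (c * t) * c).
  exact: (@is_derive1_comp _ expR (fun t => c * t)).
have := is_deriveM dexp (is_derive_transition k n t t0).
set D1 := (X in is_derive _ _ _ X); set D2 := (X in _ -> is_derive _ _ _ X).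
suff -> : D1 = D2 by [].
rewrite /D1 /D2 /W /B; rewrite /GRing.scale/=; ring.
Qed.

Lemma is_derive_expn_div (j : nat) (a t : R) :
  is_derive t 1 (fun t : R => t ^+ j.+1 / j.+1`!%:R * a) (t ^+ j / j`!%:R * a).
Proof.
have dX : is_derive t 1 (fun t : R => t ^+ j.+1) (j.+1%:R * t ^+ j).
  apply: DeriveDef; first exact: exprn_derivable.
  by rewrite exp_derive [_ *: 1]mulr1.
have := is_deriveM dX (is_derive_cst (j.+1`!%:R^-1 * a) t 1).
rewrite scaler0 add0r /GRing.scale/=.
have -> : (fun t : R => t ^+ j.+1) * cst (j.+1`!%:R^-1 * a) =
    (fun t => t ^+ j.+1 / j.+1`!%:R * a).
  by apply/funext => x; rewrite !fctE mulrA.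
suff -> : j.+1`!%:R^-1 * a * (j.+1%:R * t ^+ j) = t ^+ j / j`!%:R * a by [].
have j0 : j.+1%:R != 0 :> R by rewrite pnatr_eq0.
have f0 : j`!%:R != 0 :> R by rewrite pnatr_eq0 -lt0n fact_gt0.
rewrite factS natrM; move: (j.+1%:R) j0 (j`!%:R) f0 => A A0 C C0.
by field; rewrite A0 C0.
Qed.

Lemma poly0 (m : nat) (k n : int) : poly m.+1 k n 0 = (k == n)%:R.
Proof.
rewrite /poly big_ord_recl /= expr0 fact0 divr1 mul1r big1 ?addr0// => i _.
by rewrite exprS mul0r mul0r mul0r.
Qed.

Lemma poly_step (m : nat) (k n : int) (t : R) :
  \sum_(j < m) t ^+ j / j`!%:R * jump_weight j.+1 k n =
  u k * poly m (k + 1) n t + d k * poly m (k - 1) n t + (c - u k - d k) * poly m k n t.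
Proof.
rewrite /poly !mulr_sumr -!big_split/=; apply: eq_bigr => j _; ring.
Qed.

Lemma is_derive_poly (m : nat) (k n : int) (t : R) :
  is_derive t 1 (poly m.+1 k n)
    (u k * poly m (k + 1) n t + d k * poly m (k - 1) n t + (c - u k - d k) * poly m k n t).
Proof.
rewrite -poly_step; elim: m => [|m IH].
  have -> : poly 1 k n = cst (k == n)%:R.
    by apply/funext => x; rewrite /poly big_ord1 expr0 fact0 divr1 mul1r.
  by rewrite big_ord0; exact: is_derive_cst.
have -> : poly m.+2 k n =
    poly m.+1 k n + (fun x => x ^+ m.+1 / m.+1`!%:R * jump_weight m.+1 k n).
  by apply/funext => x; rewrite /poly big_ord_recr.
by rewrite big_ord_recr; apply: is_deriveD => //; exact: is_derive_expn_div.
Qed.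

Let c0 : 0 <= c.
Proof. by have := udc 0; have := u0 0; have := d0 0; lra. Qed.

Lemma continuous_weighted (k n : int) : continuous (W k n).
Proof.
move=> t; apply: cvgM; last exact: continuous_transition.
apply: (@continuous_comp _ _ _ (fun t => c * t) expR); last exact: continuous_expR.
by apply: cvgM; [exact: cvg_cst|exact: cvg_id].
Qed.

(** The error of order [m + 1] vanishes at 0, and its derivative combines errors of order [m] with
    nonnegative weights of sum [c]. Each step thus contributes a factor [c] and one integration in
    [t]. *)
Lemma weighted_taylor_bound (b : R) (m : nat) (k n : int) (t : R) : 0 <= t <= b ->
  `|W k n t - poly m k n t| <= t ^+ m / m`!%:R * (expR (c * b) * c ^+ m).
Proof.
elim: m k t => [|m IH] k t /andP[t0 tb].
  rewrite /poly big_ord0 subr0 !expr0 fact0 divr1 !mulr1 mul1r /W.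
  rewrite ger0_norm ?mulr_ge0 ?expR_ge0 ?FE ?p0//.
  rewrite -[leRHS]mulr1; apply: ler_pM; rewrite ?expR_ge0 ?p0//.
    by rewrite ler_expR ler_wpM2l.
  exact: transition_le1.
pose g' x := x ^+ m / m`!%:R * (expR (c * b) * c ^+ m.+1) : R.
apply: (@derive_abs_le _ (W k n - poly m.+1 k n)
  (fun x => x ^+ m.+1 / m.+1`!%:R * (expR (c * b) * c ^+ m.+1))
  (fun x => (u k * W (k + 1) n x + d k * W (k - 1) n x + (c - u k - d k) * W k n x)
    - (u k * poly m (k + 1) n x + d k * poly m (k - 1) n x
       + (c - u k - d k) * poly m k n x)) g' b); last by rewrite t0.
- apply: continuous_subspaceT => x; apply: cvgB; first exact: continuous_weighted.
  apply: differentiable_continuous; apply/derivable1_diffP.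
  by have [] := is_derive_poly m k n x.
- apply: continuous_subspaceT => x.
  apply: differentiable_continuous; apply/derivable1_diffP.
  by have [] := is_derive_expn_div m (expR (c * b) * c ^+ m.+1) x.
- move=> x /andP[x0 _]; apply: is_deriveB; first exact: is_derive_weighted.
  exact: is_derive_poly.
- by move=> x _; exact: is_derive_expn_div.
- move=> x /andP[x0 xb].
  have xb' : 0 <= x <= b by rewrite !ltW.
  have := IH (k + 1) x xb'; have := IH (k - 1) x xb'; have := IH k x xb'.
  rewrite /g'; set E := _ * (expR (c * b) * c ^+ m).
  have -> : x ^+ m / m`!%:R * (expR (c * b) * c ^+ m.+1) = c * E.
    by rewrite /E exprS; ring.
  have := udc k; have := u0 k; have := d0 k.
  move: (W _ n x) (W _ n x) (W _ n x) (poly _ _ n x) (poly _ _ n x) (poly _ _ n x).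
  move=> w1 w2 w3 y1 y2 y3 dk uk cud.
  rewrite !ler_norml => /andP[? ?] /andP[? ?] /andP[? ?].
  by apply/andP; split; nra.
- by rewrite !fctE poly0 /W mulr0 expR0 mul1r FE// transition_init// subrr.
- by rewrite exprS mul0r mul0r mul0r.
Qed.

Lemma weighted_series (k n : int) (t : R) : 0 <= t ->
  (\sum_(0 <= j <oo) (t ^+ j / j`!%:R * jump_weight j k n)%:E = (W k n t)%:E)%E.
Proof.
move=> t0; apply: cvg_lim => //.
rewrite (_ : (fun m => _) = EFin \o (fun m => poly m k n t)); last first.
  by apply/funext => m; rewrite /= sumEFin big_mkord.
apply: cvg_EFin; first exact: nearW.
apply/cvgrPdist_lt => e e0.
(* The Taylor bound at [b = t] is a term of the convergent exponential series times a constant,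
   hence tends to 0. *)
have : exp_coeff (c * t) j * expR (c * t) @[j --> \oo] --> 0 * expR (c * t).
  apply: cvgM; last exact: cvg_cst.
  by apply: cvg_series_cvg_0; exact: is_cvg_series_exp_coeff.
rewrite mul0r => /cvgrPdist_lt/(_ _ e0); apply: filterS => j.
rewrite sub0r normrN; apply: le_lt_trans; apply: le_trans (ler_norm _).
have := weighted_taylor_bound t j k n t; rewrite t0 lexx => /(_ isT) h.
apply: le_trans h _; rewrite /exp_coeff/= exprMn.
by rewrite le_eqVlt; apply/orP; left; apply/eqP; ring.
Qed.

Section eigenfunction.
Variables (phi : int -> R) (lam : R).
Hypothesis phi0 : forall n, 0 <= phi n.
Hypothesis phiE : forall k, u k * phi (k + 1) + d k * phi (k - 1)
  - (u k + d k) * phi k = lam * phi k.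

(** [phi] is an eigenvector of [c] plus the generator with eigenvalue [c + lam]; nonnegativity of
    all terms makes the sums well behaved although [phi] may be unbounded. *)
Lemma jump_weight_eigen (m : nat) (k : int) :
  (\sum_(0 <= i <oo) (jump_weight m k (int_enum i) * phi (int_enum i))%:E
    = ((c + lam) ^+ m * phi k)%:E)%E.
Proof.
rewrite -(esum_int (fun n => (jump_weight m k n * phi n)%:E)); last first.
  by move=> n; rewrite lee_fin mulr_ge0 ?jump_weight_ge0.
elim: m k => [|m IH] k.
  rewrite (esum_peel k)//; last by move=> i; rewrite lee_fin mulr_ge0// ler0n.
  rewrite /= eqxx !mul1r esum1 ?adde0// => i [_ /= /eqP ik].
  by rewrite eq_sym (negbTE ik) mul0r.
have w0 i j : (0 <= (jump_weight m i j * phi j)%:E)%E.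
  by rewrite lee_fin mulr_ge0 ?jump_weight_ge0.
have Z (a : R) i : 0 <= a ->
    (\esum_(n in [set: int]) (a%:E * (jump_weight m i n * phi n)%:E)
     = a%:E * ((c + lam) ^+ m * phi i)%:E)%E.
  move=> a0; rewrite -IH !esum_int//; last by move=> n; rewrite mule_ge0.
  by rewrite nneseriesZl.
transitivity (\esum_(n in [set: int]) ((u k)%:E * (jump_weight m (k + 1)%R n * phi n)%:E
   + (d k)%:E * (jump_weight m (k - 1)%R n * phi n)%:E
   + (c - u k - d k)%:E * (jump_weight m k n * phi n)%:E))%E.
  by apply: eq_esum => n _; rewrite -!EFinM -!EFinD; congr EFin => /=; ring.
have cud : 0 <= c - u k - d k by have := udc k; lra.
rewrite esumD; [|by move=> n _; rewrite ?adde_ge0 ?mule_ge0// ?lee_fin ..].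
rewrite esumD; [|by move=> n _; rewrite mule_ge0// ?lee_fin ..].
rewrite !Z// -!EFinM -!EFinD; congr EFin.
set M := (c + lam) ^+ m; transitivity (M *
    (u k * phi (k + 1) + d k * phi (k - 1) - (u k + d k) * phi k + c * phi k)).
  by ring.
by rewrite phiE exprS -/M; ring.
Qed.

(** Tonelli's theorem exchanges the sum over states with the exponential series, leaving
    [expR (- (c * t)) * expR (t * (c + lam))]. *)
Lemma transition_eigen (t : R) (k : int) : 0 <= t ->
  (\esum_(n in [set: int]) (p t k n * phi n)%:E = (expR (lam * t) * phi k)%:E)%E.
Proof.
move=> t0; rewrite esum_int; last by move=> n; rewrite lee_fin mulr_ge0 ?p0.
have tj0 j : 0 <= t ^+ j / j`!%:R :> R by rewrite divr_ge0 ?exprn_ge0.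
have w0 j i n : (0 <= (t ^+ j / j`!%:R * (jump_weight j i n * phi n))%:E)%E.
  by rewrite lee_fin mulr_ge0 ?tj0// mulr_ge0// jump_weight_ge0.
transitivity (\sum_(0 <= i <oo) ((expR (- (c * t)))%:E *
    \sum_(0 <= j <oo) (t ^+ j / j`!%:R *
      (jump_weight j k (int_enum i) * phi (int_enum i)))%:E))%E.
  apply: eq_eseriesr => i _.
  under [in RHS]eq_eseriesr do rewrite mulrA mulrC EFinM.
  rewrite nneseriesZl; last first.
    by move=> j _; rewrite lee_fin mulr_ge0// jump_weight_ge0.
  rewrite weighted_series// -!EFinM; congr EFin; rewrite /W FE//.
  by rewrite mulrCA [_ * (expR (c * t) * _)]mulrA -expRD addNr expR0 mul1r mulrC.
rewrite nneseriesZl; last by move=> i _; apply: nneseries_ge0.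
rewrite nneseries_interchange//.
under eq_eseriesr => j _.
  under eq_eseriesr do rewrite EFinM.
  rewrite nneseriesZl; last first.
    by move=> i _; rewrite lee_fin mulr_ge0// jump_weight_ge0.
  rewrite jump_weight_eigen -EFinM.
  have -> : t ^+ j / j`!%:R * ((c + lam) ^+ j * phi k) =
      phi k * ((t * (c + lam)) ^+ j / j`!%:R) by rewrite exprMn; ring.
  rewrite EFinM.
  over.
have -> : (\sum_(0 <= j <oo) ((phi k)%:E * ((t * (c + lam)) ^+ j / j`!%:R)%:E)
    = (phi k * expR (t * (c + lam)))%:E)%E.
  apply: cvg_lim => //.
  rewrite (_ : (fun m => _) = EFin \o
      (fun m => phi k * series (exp_coeff (t * (c + lam))) m)); last first.
    apply/funext => m /=; rewrite /series/= mulr_sumr -sumEFin.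
    by apply: eq_bigr => j _; rewrite -EFinM.
  apply: cvg_EFin; first exact: nearW.
  by apply: cvgM; [exact: cvg_cst|exact: is_cvg_series_exp_coeff].
rewrite -EFinM; congr EFin; rewrite mulrCA -expRD mulrC; congr (expR _ * _).
by ring.
Qed.

End eigenfunction.

End birth_death.

(** * Exponential moments of the tempered subordinator *)

Section density.
Context {d} {T : measurableType d} {R : realType} (P : probability T R).
Variables (Y : T -> R) (f : R -> R).
Hypothesis mY : measurable_fun setT Y.
Hypothesis Yf : has_density P Y f.
Local Notation mu := (@lebesgue_measure R).

Let mf : measurable_fun setT f. Proof. exact: density_measurable Yf. Qed.
Let f0 x : 0 <= f x. Proof. exact: density_ge0 Yf x. Qed.

Lemma integral_density_indic (A : set R) (r : R) : measurable A -> 0 <= r ->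
  (\int[P]_w (r * \1_A (Y w))%:E = \int[mu]_x (r * \1_A x * f x)%:E)%E.
Proof.
move=> mA r0.
have mYA : measurable (Y @^-1` A) by rewrite -[X in measurable X]setTI; exact: mY.
transitivity (r%:E * P (Y @^-1` A))%E.
  under eq_integral do rewrite EFinM.
  rewrite ge0_integralZl_EFin//.
  - by congr (_ * _)%E; rewrite -[in RHS](setIT (Y @^-1` A)) -integral_indic.
  - by apply/measurable_EFinP; apply: measurable_indic.
rewrite -[Y @^-1` A]/[set w | A (Y w)] (density_law Yf)//.
under [RHS]eq_integral do rewrite -mulrA EFinM.
rewrite ge0_integralZl_EFin//.
- congr (_ * _)%E; rewrite [LHS]integral_mkcond; apply: eq_integral => x _.
  by rewrite patchE indicE; case: ifPn; rewrite ?mul1r ?mul0r.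
- by move=> x _; rewrite lee_fin mulr_ge0.
- by apply/measurable_EFinP; apply: measurable_funM.
Qed.

Import HBNNSimple.

Lemma integral_density_nnsfun (g : {nnsfun R >-> R}) :
  (\int[P]_w (g (Y w))%:E = \int[mu]_x (g x * f x)%:E)%E.
Proof.
under [LHS]eq_integral do rewrite fimfunE -fsumEFin//.
rewrite [LHS]ge0_integral_fsum//; last 2 first.
  - move=> r; apply/measurable_EFinP; apply: measurable_funM => //.
    by apply: measurableT_comp => //.
  - by move=> r w _; exact: nnfun_muleindic_ge0.
under [RHS]eq_integral.
  move=> x _; rewrite fimfunE EFinM -fsumEFin// ge0_mule_fsuml; last first.
    by move=> r; exact: nnfun_muleindic_ge0.
  over.
rewrite [RHS]ge0_integral_fsum//; last 2 first.
  - move=> r; under eq_fun do rewrite -EFinM.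
    apply/measurable_EFinP; apply: measurable_funM => //.
    apply: (measurable_funM (measurable_cst _)); apply: measurable_indic.
    have mg : measurable_fun setT g by exact: measurable_funPT.
    by rewrite -[X in measurable X]setTI; apply: mg; rewrite //; exact: measurable_set1.
  - by move=> r x _; rewrite mule_ge0 ?lee_fin// -lee_fin nnfun_muleindic_ge0.
apply: eq_fsbigr => r /set_mem[x _ <-].
exact: integral_density_indic.
Qed.

(** The density is known through probabilities of sets only; simple functions and monotone
    convergence extend it to nonnegative integrands. *)
Lemma integral_density (g : R -> R) : measurable_fun setT g -> (forall x, 0 <= g x) ->
  (\int[P]_w (g (Y w))%:E = \int[mu]_x (g x * f x)%:E)%E.
Proof.
move=> mg g0.
have mEg : measurable_fun setT (EFin \o g) by exact/measurable_EFinP.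
pose g_ := nnsfun_approx measurableT mEg.
have mg_ n : measurable_fun setT (g_ n) by exact: measurable_funPT.
have g_cvg x : (g_ n x)%:E @[n --> \oo] --> (g x)%:E.
  by apply: (@cvg_nnsfun_approx _ _ _ _ measurableT _ mEg) => // y _; rewrite lee_fin.
have g_nd x : {homo (fun n => g_ n x) : m n / (m <= n)%N >-> m <= n}.
  by move=> m n mn; exact/lefP/nd_nnsfun_approx.
transitivity (limn (fun n => \int[P]_w (g_ n (Y w))%:E)%E).
  rewrite -monotone_convergence//=.
  - by apply: eq_integral => w _; apply/esym/cvg_lim => //; exact: g_cvg.
  - by move=> n; apply/measurable_EFinP; apply: measurableT_comp.
  - by move=> n w _; rewrite lee_fin.
  - by move=> w _ m n mn; rewrite lee_fin; exact: g_nd.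
transitivity (limn (fun n => \int[mu]_x (g_ n x * f x)%:E)%E).
  by apply: congr_lim; apply/funext => n /=; exact: integral_density_nnsfun.
rewrite -monotone_convergence//=.
- apply: eq_integral => x _; apply/cvg_lim => //.
  under eq_fun do rewrite EFinM.
  by rewrite EFinM; apply: cvgeZr => //; exact: g_cvg.
- move=> n; apply/measurable_EFinP; apply: measurable_funM => //.
  exact: mg_.
- by move=> n x _; rewrite lee_fin mulr_ge0.
- by move=> x _ m n mn; rewrite lee_fin ler_wpM2r// g_nd.
Qed.

End density.

(** The tempering factor shifts the exponent from [a] to [a - mu <= 0], where the stable moment is
    finite. The two subordinators may live on different spaces and are linked only by [f]. *)
Lemma tempered_mgf {R : realType} {d d' : measure_display} {T : measurableType d}
    {T' : measurableType d'} (P : probability T R) (P' : probability T' R)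
    (nu mu : R) (S : R -> T' -> R) (f : R -> R -> R) (St : R -> T -> R) :
  stable_subordinator P' nu S ->
  (forall t : R, 0 < t -> has_density P' (S t) (f t)) ->
  tempered_stable_subordinator P nu mu f St ->
  forall t a : R, 0 < t -> a <= mu ->
  (\int[P]_w (expR (a * St t w))%:E
    = (expR (t * (mu `^ nu - (mu - a) `^ nu)))%:E)%E.
Proof.
move=> hS hf hSt t a t0 amu.
have mS : measurable_fun setT (S t).
  by apply: (subordinator_measurable (stable_is_subordinator hS)); exact: ltW.
have mSt : measurable_fun setT (St t).
  by apply: (subordinator_measurable (tempered_is_subordinator hSt)); exact: ltW.
have mexp (r : R) : measurable_fun setT (fun x : R => expR (r * x)).
  by apply: measurableT_comp => //; exact: measurable_funM.
have mft : measurable_fun setT (f t) by exact: density_measurable (hf _ t0).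
rewrite (integral_density _ _ _ mSt (tempered_density hSt t0) (fun x => expR (a * x)))//.
transitivity ((expR (mu `^ nu * t))%:E * \int[P']_w (expR ((a - mu) * S t w))%:E)%E.
  rewrite (integral_density _ _ _ mS (hf _ t0) (fun x => expR ((a - mu) * x)))//.
  rewrite -ge0_integralZl_EFin ?expR_ge0//.
  - apply: eq_integral => x _; rewrite -EFinM; congr EFin.
    rewrite !mulrA -!expRD; congr (expR _ * _); ring.
  - by move=> x _; rewrite lee_fin mulr_ge0 ?expR_ge0//; exact: density_ge0 (hf _ t0) x.
  - apply/measurable_EFinP; apply: measurable_funM; [exact: mexp|exact: mft].
rewrite (stable_mgf_le0 hS)// ?subr_le0// -EFinM -expRD.
by rewrite distrC ger0_norm ?subr_ge0//; congr (expR _)%:E; ring.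
Qed.

(** * Independent time change *)

Section countable_partition.
Context {d} {T : measurableType d} {R : realType} (P : probability T R).
Variables (G : nat -> set T) (v : nat -> R) (g : T -> R).
Hypothesis mG : forall i, measurable (G i).
Hypothesis tG : trivIset setT G.
Hypothesis GT : \bigcup_i G i = setT.
Hypothesis gv : forall i w, G i w -> g w = v i.

Lemma measurable_fun_partition : measurable_fun setT g.
Proof.
move=> _ A mA; rewrite setTI.
have -> : g @^-1` A = \bigcup_(i in [set i | A (v i)]) G i.
  apply/seteqP; split => [w Aw|w [i Ai Giw]]; last by rewrite /preimage/= (gv _ _ Giw).
  have [i _ Giw] : (\bigcup_i G i) w by rewrite GT.
  by exists i => //=; rewrite -(gv _ _ Giw).
exact: bigcup_measurable.
Qed.

Lemma measure_partition (A : set T) : measurable A ->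
  P A = (\sum_(0 <= i <oo) P (A `&` G i))%E.
Proof.
move=> mA; rewrite -{1}(setIT A) -GT setI_bigcupr measure_bigcup//.
- by apply: eq_eseriesl => i; rewrite in_setT.
- by move=> i _; exact: measurableI.
- by apply: trivIset_setIl.
Qed.

Lemma integral_partition (A : set T) : measurable A -> (forall i, 0 <= v i) ->
  (\int[P]_(w in A) (g w)%:E = \sum_(0 <= i <oo) ((v i)%:E * P (A `&` G i)))%E.
Proof.
move=> mA v0.
have mAG i : measurable (A `&` G i) by exact: measurableI.
have g0 w : 0 <= g w.
  have [i _ Giw] : (\bigcup_i G i) w by rewrite GT.
  by rewrite (gv _ _ Giw).
rewrite -{1}(setIT A) -GT setI_bigcupr ge0_integral_bigcup//.
- apply: eq_eseriesr => i _; rewrite -integral_cst//.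
  by apply: eq_integral => w /set_mem[_ Giw]; rewrite (gv _ _ Giw).
- apply: measurable_funTS; apply/measurable_EFinP; exact: measurable_fun_partition.
- by move=> w _; rewrite lee_fin.
- exact: trivIset_setIl.
Qed.

End countable_partition.

Lemma trivIset_level {T : Type} {I : Type} (f : T -> I) (e : nat -> I) :
  injective e -> trivIset setT (fun i => [set w | f w = e i]).
Proof. by move=> ei i j _ _ [w [/= -> /ei]]. Qed.

Section time_changed_law.
Context {d} {T : measurableType d} {R : realType} (P : probability T R).
Variables (p : R -> int -> int -> R) (X : R -> T -> int) (k : int).
Hypothesis hX : markov_chain P p X.
Hypothesis X0k : (0 < P [set w | X 0 w = k])%E.

Let B := [set w | X 0 w = k].

Let ptr : transition_function p. Proof. exact: chain_transition hX. Qed.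

Let mX s n : 0 <= s -> measurable [set w | X s w = n].
Proof. exact: (chain_measurable hX). Qed.

Let mB : measurable B. Proof. exact: mX. Qed.

Lemma chain_joint_law (s : R) (n : int) : 0 <= s ->
  P (B `&` [set w | X s w = n]) = (P B * (p s k n)%:E)%E.
Proof.
rewrite le_eqVlt => /predU1P[<-|s0].
  rewrite (transition_init ptr); have [<-|kn] := eqVneq k n.
    by rewrite setIid mule1.
  rewrite (_ : _ `&` _ = set0) ?measure0 ?mule0//.
  by apply/seteqP; split => // w [/= -> /eqP]; rewrite (negbTE kn).
(* The Markov property wants a whole strictly increasing sequence of times; only the entries 0 and
   [s] matter, and [s = 0] was treated apart. *)
pose tt (i : nat) : R := i%:R * s.
pose nn (i : nat) : int := if i is 0%N then k else n.
have tt0 : 0 <= tt 0%N by rewrite /tt mul0r.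
have ttm : {homo tt : i j / (i < j)%N >-> i < j}.
  by move=> i j ij; rewrite /tt ltr_pM2r// ltr_nat.
have pastE : \bigcap_(i in `I_1) [set w | X (tt i) w = nn i] = B.
  apply/seteqP; split => [w /(_ 0%N isT)/=|w Bw i /=]; first by rewrite /tt mul0r.
  by rewrite ltnS leqn0 => /eqP ->; rewrite /tt mul0r.
have := @markov_property _ _ _ _ _ _ hX 0%N tt nn tt0 ttm; rewrite /= pastE => /(_ X0k).
rewrite /cond_prob /tt mul1r mul0r subr0 setIC => h.
have finB : P B \is a fin_num by exact: fin_num_measure.
have finBX : P (B `&` [set w | X s w = n]) \is a fin_num.
  by apply: fin_num_measure; apply: measurableI => //; apply: mX; exact: ltW.
have B0 : fine (P B) != 0 by rewrite gt_eqF// fine_gt0// X0k ltey_eq finB.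
rewrite -(fineK finB) -(fineK finBX) -EFinM; congr EFin.
by rewrite -h mulrC divfK.
Qed.

Variable tau : T -> R.
Hypothesis mtau : measurable_fun setT tau.
Hypothesis tau0 : forall w, 0 <= tau w.
Hypothesis indep : forall (s : R) (n : int) (A : set R), 0 <= s -> measurable A ->
  P ((B `&` [set w | X s w = n]) `&` tau @^-1` A) =
  (P (B `&` [set w | X s w = n]) * P (tau @^-1` A))%E.
Hypothesis pcont : forall n, continuous (fun s : R => p (Num.max 0 s) k n).
Hypothesis p_le1 : forall (s : R) n, 0 <= s -> p s k n <= 1.

Let grid (m j : nat) : R := j.+1%:R / m.+1%:R.

Let slab (m j : nat) : set T := tau @^-1` `[j%:R / m.+1%:R, grid m j[.

(* A discretization of tau from strictly above, so that the right-continuity of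
   the paths of X applies. *)
Let tau_ (m : nat) (w : T) : R := grid m (Num.trunc (tau w * m.+1%:R)).

Let slabP m j w : slab m j w <-> Num.trunc (tau w * m.+1%:R) = j.
Proof.
have m0 : 0 < m.+1%:R :> R by rewrite ltr0n.
have x0 : 0 <= tau w * m.+1%:R by rewrite mulr_ge0.
rewrite /slab /grid /preimage/= in_itv/= ler_pdivrMr// ltr_pdivlMr//.
split => [|<-]; last exact: truncn_itv.
by move=> h; apply/eqP; rewrite truncn_eq.
Qed.

Let mslab m j : measurable (slab m j).
Proof. by rewrite -[X in measurable X]setTI; exact: mtau. Qed.

Let tslab m : trivIset setT (slab m).
Proof. by move=> i j _ _ [w [/slabP <- /slabP]]. Qed.

Let slabT m : \bigcup_j slab m j = setT.
Proof. by apply/seteqP; split => // w _; eexists; last exact/slabP. Qed.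

Let tau_slab m j w : slab m j w -> tau_ m w = grid m j.
Proof. by rewrite /tau_ => /slabP ->. Qed.

Let grid_ge0 m j : 0 <= grid m j. Proof. by rewrite /grid divr_ge0. Qed.

Let tau_gt m w : tau w < tau_ m w <= tau w + m.+1%:R^-1.
Proof.
have m0 : 0 < m.+1%:R :> R by rewrite ltr0n.
have x0 : 0 <= tau w * m.+1%:R by rewrite mulr_ge0.
have /andP[h1 h2] := truncn_itv x0.
rewrite /tau_ /grid ltr_pdivlMr// h2/= ler_pdivrMr// mulrDl mulVf ?gt_eqF//.
by rewrite -natr1 lerD2r.
Qed.

Let tau_cvg w : tau_ m w @[m --> \oo] --> tau w.
Proof.
apply/cvgrPdist_lt => e e0; near=> m.
have /andP[h1 h2] := tau_gt m w.
rewrite distrC gtr0_norm ?subr_gt0// ltrBlDl (le_lt_trans h2)// ltrD2l.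
by near: m; exact: (near_infty_natSinv_lt (PosNum e0)).
Unshelve. all: by end_near. Qed.

Let near_X w : \forall m \near \oo, X (tau_ m w) w = X (tau w) w.
Proof.
have := chain_right_continuous hX w (tau0 w); rewrite near_withinE => -[/= e e0 he].
near=> m; have /andP[h1 h2] := tau_gt m w.
apply: he => //=; rewrite distrC gtr0_norm ?subr_gt0// ltrBlDl (le_lt_trans h2)// ltrD2l.
by near: m; exact: (near_infty_natSinv_lt (PosNum e0)).
Unshelve. all: by end_near. Qed.

Let E_ (m : nat) (n : int) := [set w | X (tau_ m w) w = n].
Let E (n : int) := [set w | X (tau w) w = n].

Let mE_ m n : measurable (E_ m n).
Proof.
have -> : E_ m n = \bigcup_j (slab m j `&` [set w | X (grid m j) w = n]).
  apply/seteqP; split => [w Ew|w [j _ [/tau_slab wj /= Xn]]]; last by rewrite /E_/= wj.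
  have [j _ wj] : (\bigcup_j slab m j) w by rewrite slabT.
  by exists j => //; split => //=; rewrite -(tau_slab _ _ _ wj).
by apply: bigcup_measurable => j _; apply: measurableI => //; exact: mX.
Qed.

(** The states are discrete, so right-continuity gives equality of [X] at [tau_ m w] and at [tau w]
    from some [m] on; the event is the lower limit of the discretized ones. *)
Lemma time_change_measurable (n : int) : measurable (E n).
Proof.
have -> : E n = \bigcup_M \bigcap_(m in [set m | (M <= m)%N]) E_ m n.
  apply/seteqP; split => w.
    move=> En; have [M _ hM] := near_X w.
    by exists M => // m /= Mm; rewrite /E_/= (hM m).
  move=> [M _ hM]; have [M' _ hM'] := near_X w.
  have := hM (maxn M M') (leq_maxl _ _); rewrite /E_/= (hM' (maxn M M'))//=.
  exact: leq_maxr.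
apply: bigcup_measurable => M _; apply: bigcap_measurable => //; first by exists M => /=.
Qed.

(** On each slab the random time is a constant, so independence is applied at a fixed time of the
    chain. *)
Lemma grid_law (m : nat) (n : int) :
  P (B `&` E_ m n) = (P B * \int[P]_w (p (tau_ m w) k n)%:E)%E.
Proof.
have p0 j : 0 <= p (grid m j) k n by exact: (transition_ge0 ptr).
rewrite (integral_partition P (slab m) (fun j => p (grid m j) k n))//; last first.
  by move=> j w /tau_slab ->.
rewrite (measure_partition P (slab m))//; last exact: measurableI.
rewrite -(fineK (fin_num_measure P _ mB)) -nneseriesZl; last first.
  by move=> j _; rewrite mule_ge0 ?lee_fin.
apply: eq_eseriesr => j _; rewrite fineK ?fin_num_measure// setTI.
rewrite muleA -chain_joint_law// -indep//; congr (P _).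
apply/seteqP; split => w /= [[Bw h] wj]; (split; last exact: wj); split => //;
  by move: h; rewrite /E_/= (tau_slab _ _ _ wj).
Qed.

(** Dominated convergence on both sides of [grid_law]: indicators are eventually constant on the
    left, and [p] is continuous in time on the right. *)
Lemma time_change_law (n : int) :
  P (B `&` E n) = (P B * \int[P]_w (p (tau w) k n)%:E)%E.
Proof.
have mE := time_change_measurable n.
have tau_ge0 m w : 0 <= tau_ m w by exact: grid_ge0.
have lhs : P (B `&` E_ m n) @[m --> \oo] --> P (B `&` E n).
  have PI A : measurable A -> P (B `&` A) = (\int[P]_(w in B) (\1_A w)%:E)%E.
    by move=> mA; rewrite integral_indic// setIC.
  rewrite PI//; under eq_fun do rewrite PI//.
  apply: (@dominated_cvg _ _ _ P B mB (fun m w => (\1_(E_ m n) w)%:E)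
    (fun w => (\1_(E n) w)%:E) (EFin \o cst 1)) => //.
  - by move=> m; apply/measurable_EFinP; exact: measurable_indic.
  - move=> w _; apply: cvg_near_cst; apply: filterS (near_X w) => m Xm.
    have EE : E_ m n w <-> E n w by rewrite /E_ /E/= Xm.
    have [h|h] := pselect (E n w); rewrite !indicE.
      by rewrite !mem_set//; exact/EE.
    by rewrite !memNset// => /EE.
  - exact: finite_measure_integrable_cst.
  - by move=> m w _; rewrite lee_fin indicE; case: (_ \in _); rewrite ?normr1 ?normr0.
have rhs : (P B * \int[P]_w (p (tau_ m w) k n)%:E)%E @[m --> \oo] -->
    (P B * \int[P]_w (p (tau w) k n)%:E)%E.
  apply: cvgeZl; first exact: fin_num_measure.
  have pm m : measurable_fun setT (fun w => p (tau_ m w) k n).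
    apply: (measurable_fun_partition (slab m) (fun j => p (grid m j) k n)) => //.
    by move=> j w /tau_slab ->.
  apply: (@dominated_cvg _ _ _ P setT measurableT (fun m w => (p (tau_ m w) k n)%:E)
    (fun w => (p (tau w) k n)%:E) (EFin \o cst 1)) => //.
  - by move=> m; apply/measurable_EFinP.
  - move=> w _; apply: cvg_EFin; first exact: nearW.
    have := cvg_comp _ _ (tau_cvg w) (pcont n (tau w)).
    rewrite max_r//; apply: cvg_trans; apply: near_eq_cvg; apply: nearW => m /=.
    by rewrite max_r.
  - exact: finite_measure_integrable_cst.
  - move=> m w _; rewrite lee_fin ger0_norm ?p_le1//.
    exact: (transition_ge0 ptr).
apply: cvg_unique rhs => //.
by move: lhs; under eq_fun do rewrite grid_law.
Qed.

Let EiT : \bigcup_i E (int_enum i) = setT.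
Proof.
apply/seteqP; split => // w _.
have [_ _ /(_ (X (tau w) w) I)[i _ ei]] := int_enum_bij.
by exists i.
Qed.

Let tE : trivIset setT (fun i => E (int_enum i)).
Proof.
apply: trivIset_level; have [_ inj _] := int_enum_bij.
by move=> i j /inj; apply; rewrite in_setT.
Qed.

Lemma measurable_fun_time_change (phi : int -> R) :
  measurable_fun setT (fun w => phi (X (tau w) w)).
Proof.
apply: (measurable_fun_partition (fun i => E (int_enum i)) (phi \o int_enum)) => //.
- by move=> i; exact: time_change_measurable.
- by move=> i w /= <-.
Qed.

(** Summing the law over states and exchanging with the integral lets the eigenvalue identity act
    pointwise at the time [tau w]. *)
Lemma integral_time_change (phi : int -> R) (lam : R) : (forall n, 0 <= phi n) ->
  (forall s : R, 0 <= s ->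
    (\esum_(n in [set: int]) (p s k n * phi n)%:E = (expR (lam * s) * phi k)%:E)%E) ->
  (\int[P]_(w in B) (phi (X (tau w) w))%:E =
    P B * ((phi k)%:E * \int[P]_w (expR (lam * tau w))%:E))%E.
Proof.
move=> phi0 hphi.
have p0 s n : 0 <= s -> 0 <= p s k n by exact: (transition_ge0 ptr).
have mp n : measurable_fun setT (fun w => p (tau w) k n).
  have -> : (fun w => p (tau w) k n) = (fun s => p (Num.max 0 s) k n) \o tau.
    by apply/funext => w /=; rewrite max_r.
  by apply: measurableT_comp => //; exact: continuous_measurable_fun.
have mEi i : measurable (E (int_enum i)) by exact: time_change_measurable.
rewrite (integral_partition P (fun i => E (int_enum i)) (phi \o int_enum))//; last 2 first.
- by move=> i w /= <-.
- by move=> i /=; exact: phi0.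
under eq_eseriesr do rewrite time_change_law muleCA.
have PB : (P B)%E = (fine (P B))%:E by rewrite fineK// fin_num_measure.
rewrite PB nneseriesZl -?PB; last first.
  move=> i _; apply: mule_ge0; first by rewrite lee_fin/=.
  by apply: integral_ge0 => w _; rewrite lee_fin p0.
congr (_ * _)%E.
have hM i : ((phi (int_enum i))%:E * \int[P]_w (p (tau w) k (int_enum i))%:E =
    \int[P]_w ((phi (int_enum i))%:E * (p (tau w) k (int_enum i))%:E))%E.
  by rewrite ge0_integralZl_EFin//; first
    [by move=> w _; rewrite lee_fin p0|exact/measurable_EFinP|exact: phi0].
under eq_eseriesr do rewrite /= hM.
rewrite -integral_nneseries//; last 2 first.
- by move=> i; apply: emeasurable_funM => //; exact/measurable_EFinP.
- by move=> i w _; rewrite mule_ge0 ?lee_fin ?p0 ?phi0.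
rewrite -ge0_integralZl_EFin//; last first.
- apply/measurable_EFinP; apply: measurableT_comp => //; exact: measurable_funM.
apply: eq_integral => w _; rewrite -EFinM mulrC -hphi// esum_int; last first.
  by move=> n; rewrite lee_fin mulr_ge0 ?p0.
by apply: eq_eseriesr => i _; rewrite -EFinM mulrC.
Qed.

End time_changed_law.

(** * Tilting by the Perron eigenfunction *)

Section conditioned_measure.
Context {d} {T : measurableType d} {R : realType} (P : probability T R).
Variable B : set T.
Hypothesis mB : measurable B.
Hypothesis PB : (0 < P B)%E.

(** Conditioning on [B] as a genuine probability, to which [gartner_ellis] applies. The last [P] is
    the default of [mnormalize] for a null or infinite total mass. *)
Definition conditioned : probability T R := mnormalize (mrestr P mB) P.

Lemma conditionedE (A : set T) :
  conditioned A = (P (A `&` B) * (fine (P B))^-1%:E)%E.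
Proof.
have -> : conditioned A = mnormalize (mrestr P mB) P A by [].
rewrite /mnormalize /= /mrestr setTI ifF//.
apply/negbTE; rewrite negb_or gt_eqF//=.
by rewrite lt_eqF// ltey_eq fin_num_measure.
Qed.

Lemma integral_conditioned_partition (G : nat -> set T) (v : nat -> R) (g : T -> R) :
  (forall i, measurable (G i)) -> trivIset setT G -> \bigcup_i G i = setT ->
  (forall i w, G i w -> g w = v i) -> (forall i, 0 <= v i) ->
  (\int[conditioned]_w (g w)%:E
    = (fine (P B))^-1%:E * \int[P]_(w in B) (g w)%:E)%E.
Proof.
move=> mG tG GT gv v0.
rewrite (integral_partition conditioned G v)// (integral_partition P G v)//.
rewrite -nneseriesZl; last by move=> i _; rewrite mule_ge0 ?lee_fin.
apply: eq_eseriesr => i _.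
by rewrite [conditioned _]conditionedE setTI muleA muleC (setIC B).
Qed.

End conditioned_measure.

(** * The eigenfunction of the alternating chain *)

Section alternating_eigenfunction.
Context {R : realType} (a1 a2 b1 b2 : R).
Hypotheses (a10 : 0 < a1) (a20 : 0 < a2) (b10 : 0 < b1) (b20 : 0 < b2).
Variable g : R.

Let A := a1 * expR g + a2 * expR (- g).
Let C := Lambda a1 a2 b1 b2 g + (a1 + a2).

(* (A, C) is the Perron eigenvector of the generator compressed to the two
   parity classes. *)
Definition parity_weight (n : int) : R := if odd `|n|%N then C else A.

Definition tilt (n : int) : R := expR (g * n%:~R) * parity_weight n.

Let sq := Num.sqrt (Lambda_disc a1 a2 b1 b2 g).

Let sq2 : sq ^+ 2 = (a1 + a2 - (b1 + b2)) ^+ 2 +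
  4 * A * (b1 * expR g + b2 * expR (- g)).
Proof. by rewrite /sq sqr_sqrtr// ltW// Lambda_disc_gt0. Qed.

Let A0 : 0 < A. Proof. by rewrite addr_gt0// mulr_gt0// expR_gt0. Qed.

Let B0 : 0 < b1 * expR g + b2 * expR (- g).
Proof. by rewrite addr_gt0// mulr_gt0// expR_gt0. Qed.

Let LE : Lambda a1 a2 b1 b2 g = (sq - (a1 + a2 + b1 + b2)) / 2.
Proof. exact: LambdaE. Qed.

Let C0 : 0 < C.
Proof.
suff : b1 + b2 - (a1 + a2) < sq by rewrite /C LE => ?; lra.
(* The square of [sq] exceeds that of the difference of the exit rates by a positive product of
   off-diagonal entries. *)
rewrite ltNge; apply/negP => h.
have : sq ^+ 2 <= (b1 + b2 - (a1 + a2)) ^+ 2.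
  by rewrite ler_pXn2r ?nnegrE ?sqrtr_ge0 ?(le_trans _ h) ?sqrtr_ge0.
by rewrite sq2; have := mulr_gt0 A0 B0; nra.
Qed.

Lemma parity_weight_bounds : exists m M, [/\ 0 < m, 0 < M &
  forall n, m <= parity_weight n <= M].
Proof.
exists (Num.min A C), (Num.max A C); split; first by rewrite lt_min A0 C0.
  by rewrite lt_max A0.
by move=> n; rewrite /parity_weight; case: ifP => _; rewrite ge_min le_max !lexx ?orbT.
Qed.

(** For even [k] this is the definition of [C]; for odd [k] it is the characteristic equation
    [CC]. *)
Lemma tilt_eigen (k : int) :
  let u k := if odd `|k|%N then b1 else a1 in
  let d k := if odd `|k|%N then b2 else a2 in
  u k * tilt (k + 1) + d k * tilt (k - 1) - (u k + d k) * tilt k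
  = Lambda a1 a2 b1 b2 g * tilt k.
Proof.
have oS : odd `|k + 1| = ~~ odd `|k| by lia.
have oP : odd `|k - 1| = ~~ odd `|k| by lia.
have eS : expR (g * (k + 1)%:~R) = expR (g * k%:~R) * expR g.
  by rewrite intrD mulrDr mulr1 expRD.
have eP : expR (g * (k - 1)%:~R) = expR (g * k%:~R) * expR (- g).
  by rewrite intrD mulrDr mulrN1 expRD.
have CC : C * (Lambda a1 a2 b1 b2 g + (b1 + b2)) = A * (b1 * expR g + b2 * expR (- g)).
  by rewrite /C LE; have := sq2; nra.
rewrite /tilt /parity_weight oS oP eS eP /=; case: (odd `|k|) => /=.
  transitivity (expR (g * k%:~R) * (A * (b1 * expR g + b2 * expR (- g)) - (b1 + b2) * C)).
    by ring.
  by rewrite -CC; ring.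
by rewrite /C /A; ring.
Qed.

End alternating_eigenfunction.

(** * The time-changed chain *)

Section tempered_chain.
Context {R : realType} (a1 a2 b1 b2 nu mu : R)
  {d : measure_display} {T : measurableType d} (P : probability T R)
  (p : R -> int -> int -> R) (X : R -> T -> int)
  {d' : measure_display} {T' : measurableType d'} (P' : probability T' R)
  (S : R -> T' -> R) (f : R -> R -> R) (St : R -> T -> R) (k : int).
Hypotheses (a10 : 0 < a1) (a20 : 0 < a2) (b10 : 0 < b1) (b20 : 0 < b2).
Hypotheses (nu0 : 0 < nu) (nu1 : nu < 1) (mu0 : 0 < mu).
Hypothesis hX : markov_chain P p X.
Hypothesis hp : has_generator p (alternating_generator a1 a2 b1 b2).
Hypothesis hS : stable_subordinator P' nu S.
Hypothesis hf : forall t : R, 0 < t -> has_density P' (S t) (f t).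
Hypothesis hSt : tempered_stable_subordinator P nu mu f St.
Hypothesis hind : independent_processes P X St.

Let B := [set w | X 0 w = k].
Hypothesis PB : (0 < P B)%E.

Let ptr : transition_function p. Proof. exact: chain_transition hX. Qed.

Let mX s n : 0 <= s -> measurable [set w | X s w = n].
Proof. exact: (chain_measurable hX). Qed.

Let mB : measurable B. Proof. exact: mX. Qed.

Let Q := conditioned P B mB.

Let u (n : int) : R := if odd `|n|%N then b1 else a1.
Let v (n : int) : R := if odd `|n|%N then b2 else a2.
Let c : R := a1 + a2 + b1 + b2.

Let u0 n : 0 <= u n. Proof. by rewrite /u; case: ifP => _; exact: ltW. Qed.

Let v0 n : 0 <= v n. Proof. by rewrite /v; case: ifP => _; exact: ltW. Qed.

Let uvc n : u n + v n <= c.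
Proof.
rewrite /u /v /c; case: (odd _).
  by rewrite -addrA lerDr addr_ge0// ltW.
by rewrite -addrA lerDl addr_ge0// ltW.
Qed.

Let tau_measurable t : 0 < t -> measurable_fun setT (St t).
Proof.
by move=> t0; apply: (subordinator_measurable (tempered_is_subordinator hSt)); exact: ltW.
Qed.

Let tau_ge0 t w : 0 < t -> 0 <= St t w.
Proof.
move=> t0; rewrite -(subordinator_init (tempered_is_subordinator hSt) w).
by apply: (subordinator_nondecreasing (tempered_is_subordinator hSt)) => //; exact: ltW.
Qed.

Let tau_indep t (s : R) (n : int) (A : set R) : 0 < t -> 0 <= s -> measurable A ->
  P ((B `&` [set w | X s w = n]) `&` St t @^-1` A) =
  (P (B `&` [set w | X s w = n]) * P (St t @^-1` A))%E.
Proof.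
move=> t0 s0 mA; apply: hind.
  apply: (@measurableI _ (g_sigma_algebraType _)); apply: sub_sigma_algebra.
    by exists 0 => //; exists k.
  by exists s => //; exists n.
by apply: sub_sigma_algebra; exists t; [exact: ltW|exists A].
Qed.

Let pcont n : continuous (fun s : R => p (Num.max 0 s) k n).
Proof. exact: (continuous_transition p u v ptr hp). Qed.

Let p_le1 (s : R) n : 0 <= s -> p s k n <= 1.
Proof. exact: transition_le1. Qed.

Let level (t : R) (i : nat) : set T := [set w | X (St t w) w = int_enum i].

Lemma conditioned_tilt (g t : R) : 0 < t -> Lambda a1 a2 b1 b2 g <= mu ->
  (\int[Q]_w (tilt a1 a2 b1 b2 g (X (St t w) w))%:E =
    (tilt a1 a2 b1 b2 g k *
     expR (t * (mu `^ nu - (mu - Lambda a1 a2 b1 b2 g) `^ nu)))%:E)%E.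
Proof.
move=> t0 gmu; set phi := tilt a1 a2 b1 b2 g.
have [m [M [m0 M0 mM]]] := parity_weight_bounds a1 a2 b1 b2 a10 a20 b10 b20 g.
have phi0 n : 0 <= phi n.
  by rewrite mulr_ge0 ?expR_ge0//; have /andP[/(lt_le_trans m0)/ltW] := mM n.
have phiL s : 0 <= s -> (\esum_(n in [set: int]) (p s k n * phi n)%:E =
    (expR (Lambda a1 a2 b1 b2 g * s) * phi k)%:E)%E.
  apply: (transition_eigen p u v c ptr hp u0 v0 uvc phi) => // n.
  exact: tilt_eigen.
have mtau := tau_measurable t t0; have tau0 w := tau_ge0 t w t0.
have PBfin : P B \is a fin_num by exact: fin_num_measure.
have PB0 : fine (P B) != 0 by rewrite gt_eqF// fine_gt0// PB ltey_eq PBfin.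
rewrite (integral_conditioned_partition P B mB PB (level t) (phi \o int_enum))//.
- have -> := integral_time_change P p X k hX PB (St t) mtau tau0
    (fun s n A => tau_indep t s n A t0) pcont p_le1 phi _ phi0 phiL.
  rewrite -/B -(fineK PBfin) muleA -EFinM mulVf// mul1e.
  by rewrite (tempered_mgf _ _ _ _ _ _ _ hS hf hSt)// -EFinM.
- by move=> i; exact: (time_change_measurable P p X hX).
- apply: trivIset_level => i j; have [_ inj _] := int_enum_bij.
  by apply: inj; rewrite in_setT.
- apply/seteqP; split => // w _.
  have [_ _ /(_ (X (St t w) w) I)[i _ ei]] := int_enum_bij.
  by exists i => //=; rewrite /level/= ei.
- by move=> i w /= <-.
- by move=> i /=; exact: phi0.
Qed.

Let Z (t : R) (w : T) : R := (X (St t w) w)%:~R / t.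

Let mZ t : 0 < t -> measurable_fun setT (Z t).
Proof.
move=> t0; apply: (measurable_fun_time_change P p X hX (St t) _ _ (fun n => n%:~R / t)).
- exact: tau_measurable.
- by move=> w; exact: tau_ge0.
Qed.

Let ZE (t g : R) w : 0 < t -> t * g * Z t w = g * (X (St t w) w)%:~R.
Proof. by move=> t0; rewrite /Z; field; rewrite gt_eqF. Qed.

Lemma conditioned_mgf_bounds (g l : R) : tLambda a1 a2 b1 b2 nu mu g = l%:E ->
  exists K1 K2, [/\ 0 < K1, 0 < K2 & forall t : R, 0 < t ->
    ((K1 * expR (t * l))%:E <= \int[Q]_w (expR (t * g * Z t w))%:E
      <= (K2 * expR (t * l))%:E)%E].
Proof.
move=> /tLambda_finP[gmu ->]; set phi := tilt a1 a2 b1 b2 g.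
have [m [M [m0 M0 mM]]] := parity_weight_bounds a1 a2 b1 b2 a10 a20 b10 b20 g.
have phik : 0 < phi k.
  by rewrite mulr_gt0 ?expR_gt0//; have /andP[/(lt_le_trans m0)] := mM k.
(* With the parity weight between [m] and [M], the exponential lies between [phi / M] and [phi / m],
   and the mean of [phi] is known exactly. *)
exists (M^-1 * phi k), (m^-1 * phi k); split; do ?[by rewrite mulr_gt0 ?invr_gt0].
move=> t t0; rewrite -(mulrA M^-1) -(mulrA m^-1) (EFinM M^-1) (EFinM m^-1).
have := conditioned_tilt g t t0 gmu; rewrite -/phi => <-.
have phi0 n : 0 <= phi n.
  by rewrite mulr_ge0 ?expR_ge0//; have /andP[/(lt_le_trans m0)/ltW] := mM n.
have mphi : measurable_fun setT (fun w => (phi (X (St t w) w))).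
  apply: (measurable_fun_time_change P p X hX (St t) _ _ phi).
  - exact: tau_measurable.
  - by move=> w; exact: tau_ge0.
have mexp : measurable_fun setT (EFin \o (fun w => expR (t * g * Z t w))).
  by apply: measurable_expR_comp; apply: measurable_funM => //; exact: mZ.
have mphiM (r : R) : measurable_fun setT (fun w => (r%:E * (phi (X (St t w) w))%:E)%E).
  by apply: emeasurable_funM => //; exact/measurable_EFinP.
have intM (r : R) : 0 <= r -> (r%:E * \int[Q]_w (phi (X (St t w) w))%:E =
    \int[Q]_w (r%:E * (phi (X (St t w) w))%:E))%E.
  by move=> r0; rewrite ge0_integralZl_EFin//; first
    [by move=> w _; rewrite lee_fin|exact/measurable_EFinP].
apply/andP; split.
- rewrite intM ?invr_ge0 ?(ltW m0) ?(ltW M0)//.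
  apply: ge0_le_integral => //.
  + by move=> w _; rewrite mule_ge0 ?lee_fin// invr_ge0 ltW.
  + move=> w _; rewrite ZE// -EFinM lee_fin ler_pdivrMl// mulrC.
    by rewrite /phi /tilt ler_wpM2l ?expR_ge0//; have /andP[] := mM (X (St t w) w).
- rewrite intM ?invr_ge0 ?(ltW m0) ?(ltW M0)//.
  apply: ge0_le_integral => //.
  move=> w _; rewrite ZE// -EFinM lee_fin ler_pdivlMl// mulrC.
  by rewrite /phi /tilt ler_wpM2l ?expR_ge0//; have /andP[] := mM (X (St t w) w).
Qed.

Lemma tempered_chain_ldp :
  ldp (scaled_law P (time_change X St) k) (fun t => t)
    (legendre (tLambda a1 a2 b1 b2 nu mu)) /\
  good_rate_function (legendre (tLambda a1 a2 b1 b2 nu mu)).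
Proof.
have [e e0 [[l1 L1] [l2 L2]]] := tLambda_fin_near0 a1 a2 b1 b2 a10 a20 b10 b20 nu mu mu0.
have [|||||||hldp hgood] := @gartner_ellis _ _ _ Q Z (tLambda a1 a2 b1 b2 nu mu) mZ.
- exact: tLambdaNy.
- exact: tLambda0.
- by exists e, l1.
- by exists (- e), l2; rewrite oppr_lt0.
- move=> g l /conditioned_mgf_bounds[K1 [K2 [_ K20 h]]].
  by exists K2 => // t /h/andP[].
- move=> g l /conditioned_mgf_bounds[K1 [K2 [K10 _ h]]].
  by exists K1 => // t /h/andP[].
- exact: tLambda_derive.
split => //; apply: eq_ldp hldp => t A t0.
rewrite [LHS](conditionedE P B mB PB) /scaled_law /cond_prob.
have St0 w : St 0 w = 0 := subordinator_init (tempered_is_subordinator hSt) w.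
rewrite (_ : [set w | time_change X St 0 w = k] = B); last first.
  by apply/seteqP; split => w; rewrite /time_change /B/= St0.
rewrite EFinM fineK//; apply: fin_num_measure; apply: measurableI => //.
(* [A] is an arbitrary set here; the event is measurable as a countable union of levels of the
   integer-valued chain. *)
rewrite [X in measurable X](_ : _ =
    \bigcup_(i in [set i | A ((int_enum i)%:~R / t)]) level t i).
  apply: bigcup_measurable => i _.
  apply: (time_change_measurable P p X hX); first exact: tau_measurable.
  by move=> w; exact: tau_ge0.
apply/seteqP; split => w.
  have [_ _ /(_ (X (St t w) w) I)[i _ ei]] := int_enum_bij.
  by move=> /= Aw; exists i; rewrite /level/= ei.
by move=> [i /= Ai]; rewrite /level /time_change /= => ->.
Qed.

End tempered_chain.

Theorem proposition5p2 (R : realType) (a1 a2 b1 b2 nu mu : R)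
    (d : measure_display) (T : measurableType d) (P : probability T R)
    (p : R -> int -> int -> R) (X1 : R -> T -> int)
    (d' : measure_display) (T' : measurableType d') (P' : probability T' R)
    (S : R -> T' -> R) (f : R -> R -> R) (St : R -> T -> R) :
  0 < a1 -> 0 < a2 -> 0 < b1 -> 0 < b2 ->
  0 < nu -> nu < 1 -> 0 < mu ->
  markov_chain P p X1 ->
  has_generator p (alternating_generator a1 a2 b1 b2) ->
  stable_subordinator P' nu S ->
  (forall t : R, 0 < t -> has_density P' (S t) (f t)) ->
  tempered_stable_subordinator P nu mu f St ->
  independent_processes P X1 St ->
  forall k : int, (0 < P [set w | time_change X1 St 0 w = k])%E ->
    ldp (scaled_law P (time_change X1 St) k) (fun t => t)
        (legendre (tLambda a1 a2 b1 b2 nu mu)) /\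
    good_rate_function (legendre (tLambda a1 a2 b1 b2 nu mu)).
Proof.
move=> a10 a20 b10 b20 nu0 nu1 mu0 hX hp hS hf hSt hind k Pk.
apply: (tempered_chain_ldp a1 a2 b1 b2 nu mu P p X1 P' S f St k) => //.
move: Pk; rewrite (_ : [set w | time_change X1 St 0 w = k] = [set w | X1 0 w = k])//.
apply/seteqP; split => w;
  by rewrite /time_change /= (subordinator_init (tempered_is_subordinator hSt)).
Qed.
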